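(* Let $\eta>0$ and let $H$ be a graph with at least one edge and chromatic number $\chi(H)=r$ (so $r\ge 2$). Let $\sigma:=\sigma(H)$, $h:=|H|$ and $\omega:=(h-\sigma)/(r-1)$. Then there exists $n_0=n_0(\eta,H)\in\mathbb{N}$ such that the following holds: if $G$ is a graph on $n\ge n_0$ vertices with degree sequence $d_1\le d_2\le\dots\le d_n$ such that \[d_i\ge\left(1-\frac{\omega+\sigma}{h}\right)n+\frac{\sigma}{\omega}i\quad\text{for all } 1\le i\le \frac{\omega n}{h},\] then $G$ contains an $H$-tiling covering all but at most $\eta n$ vertices.
   Context: For a graph $H$, $\sigma(H)$ denotes the smallest possible size of a colour class over all proper colourings of $H$ with $\chi(H)$ colours. An $H$-tiling in a graph $G$ is a collection of vertex-disjoint copies of $H$ in $G$; it covers the vertices lying in these copies. The degree sequence $d_1\le\dots\le d_n$ of $G$ is the list of vertex degrees of $G$ in non-decreasing order. *)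

(* Defs.v *)
From mathcomp Require Import all_boot all_order all_algebra.
From mathcomp Require Import reals.

Set Implicit Arguments.
Unset Strict Implicit.
Unset Printing Implicit Defensive.

Import Order.TTheory GRing.Theory Num.Theory.

(* Finite simple graphs. *)
Record sgraph := SGraph {
  vertex :> finType;
  edge : rel vertex;
  edge_sym : symmetric edge;
  edge_irr : irreflexive edge }.

Definition proper_colouring (H : sgraph) k (c : {ffun H -> 'I_k}) : bool :=
  [forall x, forall y, edge x y ==> (c x != c y)].

Definition colourable (H : sgraph) (k : nat) : bool :=
  [exists c : {ffun H -> 'I_k}, proper_colouring c].

Lemma colourable_exists (H : sgraph) : exists k, colourable H k.
Proof.
exists #|H|; apply/existsP; exists [ffun x => enum_rank x].
apply/forallP => x; apply/forallP => y; apply/implyP => exy.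
by rewrite !ffunE; apply: contraTneq exy => /enum_rank_inj ->; rewrite edge_irr.
Qed.

Definition chi (H : sgraph) : nat := ex_minn (colourable_exists H).

(* No colour class has more than #|H| elements, so the default value #|H| does
   not affect the minimum as soon as H has a vertex.  By minimality of [chi H]
   every proper colouring with [chi H] colours is surjective, so only nonempty
   classes occur. *)
Definition sigma (H : sgraph) : nat :=
  \big[minn/#|H|]_(c : {ffun H -> 'I_(chi H)} | proper_colouring c)
    \big[minn/#|H|]_(j < chi H) #|[set x | c x == j]|.

Definition omega (R : realType) (H : sgraph) : R :=
  ((#|H|%:R - (sigma H)%:R) / ((chi H)%:R - 1))%R.

(* A copy of H in G, i.e. a not necessarily induced subgraph of G isomorphic
   to H, is given by an injective homomorphism from H to G. *)
Definition is_copy (H G : sgraph) (f : {ffun H -> G}) : bool :=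
  injectiveb f && [forall x, forall y, edge x y ==> edge (f x) (f y)].

Definition copy_vertices (H G : sgraph) (f : {ffun H -> G}) : {set G} :=
  [set f x | x in H].

(* When H has a vertex, two embeddings with the same image are not disjoint,
   so a tiling contains at most one embedding per copy. *)
Definition is_tiling (H G : sgraph) (T : {set {ffun H -> G}}) : bool :=
  [forall f in T, is_copy f] &&
  [forall f in T, forall g in T,
     (f != g) ==> [disjoint copy_vertices f & copy_vertices g]].

Definition covered (H G : sgraph) (T : {set {ffun H -> G}}) : {set G} :=
  \bigcup_(f in T) copy_vertices f.

Definition degree (G : sgraph) (x : G) : nat := #|[set y | edge x y]|.

Definition degree_seq (G : sgraph) : seq nat :=
  sort leq [seq degree x | x : G].

(* The paper's d_i, with i counted from 1. *)
Definition dseq (G : sgraph) (i : nat) : nat := nth 0 (degree_seq G) i.-1.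

(* Main.v *)
(** Let r = chi(H), a = omega/h, s = sigma/h, so that (r-1)a + s = 1 and s <= a.
    Call a complete r-partite subgraph a tile if each of its classes contains
    at most a proportion alpha of its vertices, where alpha is slightly larger
    than a.  Putting the smallest colour class of H into the currently smallest
    class again and again splits a large tile almost completely into copies of
    H; so it is enough to cover almost all of G by tiles of large bounded size.

    Let a tiling leave the set U uncovered.  Suppose that x in U has a positive
    proportion of neighbours in all classes of a tile K, except possibly in the
    j-th one.  As |K| is bounded, many such x have the same neighbourhood in K.
    Cut a proportional tile inside that neighbourhood off K, and put some of
    these x into its j-th class: in addition to what is there, if the j-th class
    of K has proportion clearly less than alpha, and otherwise in exchange for
    vertices of the class that have a larger degree than x.  The first move
    covers more vertices, the second one leaves vertices of larger degree
    uncovered; both decrease the potential Psi, which counts the uncovered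
    vertices, each with a weight that decreases in its degree.  A tile K in which
    x admits no move contains at most about (1-a-s)|K| + (s/a)z and at most about
    (1-a)|K| neighbours of x, where z counts the vertices of K whose degree is at
    most about deg x.  If this holds for almost all K, then summing over K
    contradicts the degree condition, provided that the latter holds with a slack
    larger than |U|/n.

    Universal vertices provide the slack.  Adding (r-1) kappa n of them to G
    gives a graph in which the condition has slack of order kappa.  For kappa = 1
    there is an obvious tiling.  Decreasing kappa in small steps destroys only
    small parts of the tiles, so that U stays small compared with the slack, and
    the moves make U negligible again.  When kappa is tiny, delete all remaining
    universal vertices. *)
Require Import Defs.
From mathcomp Require Import all_boot all_order all_algebra.
From mathcomp Require Import reals.
From mathcomp Require Import zify ring lra.
Set Implicit Arguments.
Unset Strict Implicit.
Unset Printing Implicit Defensive.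
Import Order.TTheory GRing.Theory Num.Theory.
Local Open Scope ring_scope.

(** * Finite sets and tilings by complete multipartite graphs *)

Lemma sum_bigcup_disjoint (M : nmodType) (I T : finType) (P : pred I)
    (F : I -> {set T}) (f : T -> M) :
  (forall i j, P i -> P j -> i != j -> [disjoint F i & F j]) ->
  \sum_(v in \bigcup_(i | P i) F i) f v = \sum_(i | P i) \sum_(v in F i) f v.
Proof.
(* [partition_disjoint_bigcup] is applied over all indices, so those outside [P] get the empty
   set. *)
move=> dF; pose F' i := if P i then F i else set0.
have -> : \bigcup_(i | P i) F i = \bigcup_i F' i.
  rewrite [RHS](bigID P) /= [X in _ :|: X]big1 ?setU0; last first.
    by move=> i /negbTE nPi; rewrite /F' nPi.
  by apply: eq_bigr => i Pi; rewrite /F' Pi.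
rewrite partition_disjoint_bigcup; last first.
  move=> i j nij; rewrite /F'; case Pi: (P i); case Pj: (P j);
    rewrite -setI_eq0 ?set0I ?setI0 //.
  by rewrite setI_eq0; apply: dF.
rewrite (bigID P) /= [X in _ + X]big1 ?addr0; last first.
  by move=> i /negbTE nPi; rewrite /F' nPi big_set0.
by apply: eq_bigr => i Pi; rewrite /F' Pi.
Qed.

Lemma card_setI_sum (T : finType) (A B : {set T}) :
  #|B :&: A| = (\sum_(v in A) (v \in B))%N.
Proof.
rewrite -sum1_card big_mkcond [RHS]big_mkcond /=; apply: eq_bigr => v _.
by rewrite inE; case: (v \in B); case: (v \in A).
Qed.

Lemma card_setI_bigcup (I T : finType) (P : pred I)
    (F : I -> {set T}) (B : {set T}) :
  (forall i j, P i -> P j -> i != j -> [disjoint F i & F j]) ->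
  #|B :&: \bigcup_(i | P i) F i| = (\sum_(i | P i) #|B :&: F i|)%N.
Proof.
move=> dF; rewrite card_setI_sum (sum_bigcup_disjoint _ dF).
by apply: eq_bigr => i _; rewrite card_setI_sum.
Qed.

Lemma exists_subset_card (T : finType) (B : {set T}) k :
  (k <= #|B|)%N -> exists2 A : {set T}, A \subset B & #|A| = k.
Proof.
move=> kB; exists [set x in take k (enum B)].
  by apply/subsetP => x; rewrite inE => /mem_take; rewrite mem_enum.
rewrite cardsE; apply/eqP; rewrite -[X in _ == X](@size_takel k _ (enum B)) -?cardE //.
by apply/eqP/card_uniqP; rewrite take_uniq ?enum_uniq.
Qed.

Lemma exists_between_card (T : finType) (A B : {set T}) k :
  A \subset B -> (#|A| <= k <= #|B|)%N ->
  exists C : {set T}, [/\ A \subset C, C \subset B & #|C| = k].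
Proof.
move=> sAB /andP[Ak kB].
have [|D sD cD] := @exists_subset_card _ (B :\: A) (k - #|A|).
  by rewrite cardsD (setIidPr sAB) leq_sub2r.
exists (A :|: D); split; rewrite ?subsetUl //.
  by rewrite subUset sAB (subset_trans sD) ?subsetDl.
rewrite cardsU cD; suff -> : A :&: D = set0 by rewrite cards0 subn0 subnKC.
apply/eqP; rewrite -subset0; apply/subsetP => x /setIP[xA /(subsetP sD)].
by rewrite inE xA.
Qed.

Section Tile.
Variables (R : realType) (r : nat) (V : finType) (e : rel V).
Hypotheses (e_sym : symmetric e) (e_irr : irreflexive e).
Local Notation tile := {ffun 'I_r -> {set V}}.
Implicit Types (K : tile) (T : {set tile}) (W : {set V}).

Definition supp K := \bigcup_i K i.

(** This means complete multipartite; disjointness of the classes then comes from irreflexivity of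
    [e]. *)
Definition multipartite K :=
  forall i j x y, i != j -> x \in K i -> y \in K j -> e x y.

(** The lower bound [t] on the size makes rounding errors negligible; the upper bound [t0] leaves
    only boundedly many subsets of a tile, which the pigeonhole argument relies on. *)
Definition is_tile W (al : R) (t t0 : nat) K :=
  [/\ supp K \subset W, multipartite K,
      (forall i, #|K i|%:R <= al * #|supp K|%:R) & (t <= #|supp K| <= t0)%N].

Definition cov T := \bigcup_(K in T) supp K.

Definition tiling W (al : R) (t t0 : nat) T :=
  (forall K, K \in T -> is_tile W al t t0 K) /\
  (forall K K', K \in T -> K' \in T -> K != K' -> [disjoint supp K & supp K']).

Lemma sub_supp K i : K i \subset supp K.
Proof. exact: bigcup_sup. Qed.

Lemma mem_supp K i x : x \in K i -> x \in supp K.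
Proof. exact/subsetP/sub_supp. Qed.

Lemma multipartite_disjoint K i j :
  multipartite K -> i != j -> [disjoint K i & K j].
Proof.
move=> mK nij; rewrite -setI_eq0 -subset0; apply/subsetP => x /setIP[xi xj].
by have := mK _ _ _ _ nij xi xj; rewrite e_irr.
Qed.

Lemma card_setI_supp K (B : {set V}) :
  multipartite K -> #|B :&: supp K| = (\sum_i #|B :&: K i|)%N.
Proof.
by move=> mK; rewrite card_setI_bigcup // => i j _ _; apply: multipartite_disjoint.
Qed.

Lemma card_supp K : multipartite K -> #|supp K| = (\sum_i #|K i|)%N.
Proof.
move=> mK; rewrite -[supp K]setTI card_setI_supp //.
by apply: eq_bigr => i _; rewrite setTI.
Qed.

Lemma multipartite_sub K K' :
  (forall i, K' i \subset K i) -> multipartite K -> multipartite K'.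
Proof.
move=> sK mK i j x y nij xi yj.
by apply: (mK i j) => //; [apply: (subsetP (sK i))|apply: (subsetP (sK j))].
Qed.

Lemma supp_sub K K' : (forall i, K' i \subset K i) -> supp K' \subset supp K.
Proof.
move=> sK; apply/bigcupsP => i _; exact: subset_trans (sK i) (sub_supp _ _).
Qed.

Lemma sub_cov T K : K \in T -> supp K \subset cov T.
Proof. by move=> KT; apply: bigcup_sup. Qed.

Lemma cov_sub W al t t0 T : tiling W al t t0 T -> cov T \subset W.
Proof. by case=> hT _; apply/bigcupsP => K /hT[]. Qed.

Lemma card_setI_cov T (B : {set V}) W al t t0 : tiling W al t t0 T ->
  #|B :&: cov T| = (\sum_(K in T) #|B :&: supp K|)%N.
Proof. by case=> _ dT; rewrite card_setI_bigcup. Qed.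

Lemma card_cov T W al t t0 : tiling W al t t0 T ->
  #|cov T| = (\sum_(K in T) #|supp K|)%N.
Proof.
move=> hT; rewrite -[cov T]setTI (card_setI_cov _ hT).
by apply: eq_bigr => i _; rewrite setTI.
Qed.

Lemma is_tileW W W' al al' t t' t0 t0' K : W \subset W' ->
  al <= al' -> (t' <= t)%N -> (t0 <= t0')%N ->
  is_tile W al t t0 K -> is_tile W' al' t' t0' K.
Proof.
move=> sW la lt lt0 [sK mK vK /andP[tK Kt]]; split => //.
- exact: subset_trans sK sW.
- by move=> i; rewrite (le_trans (vK i)) // ler_wpM2r.
- by rewrite (leq_trans lt) ?(leq_trans Kt).
Qed.

Lemma tilingW W W' al al' t t' t0 t0' T : W \subset W' ->
  al <= al' -> (t' <= t)%N -> (t0 <= t0')%N ->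
  tiling W al t t0 T -> tiling W' al' t' t0' T.
Proof.
by move=> sW la lt lt0 [hT dT]; split => // K /hT; apply: is_tileW.
Qed.

End Tile.

(** * Exchanging vertices between a tile and its complement *)

Section Step.
Variables (R : realType) (r : nat) (V : finType) (e : rel V).
Hypotheses (e_sym : symmetric e) (e_irr : irreflexive e).
Local Notation tile := {ffun 'I_r -> {set V}}.
Implicit Types (K : tile) (T : {set tile}) (W : {set V}).

Lemma tiling_replace W (al : R) t t0 T K K1 K2 (X Y : {set V}) :
  tiling e W al t t0 T -> K \in T ->
  is_tile e W al t t0 K1 -> is_tile e W al t t0 K2 ->
  [disjoint supp K1 & supp K2] ->
  supp K1 :|: supp K2 = (supp K :\: Y) :|: X ->
  Y \subset supp K -> [disjoint X & cov T] ->
  tiling e W al t t0 (K1 |: (K2 |: (T :\ K))) /\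
  cov (K1 |: (K2 |: (T :\ K))) = (cov T :\: Y) :|: X.
Proof.
move=> [hT dT] KT h1 h2 d12 s12 sY dX.
have disj K' : K' \in T :\ K -> [disjoint supp K' & supp K1 :|: supp K2].
  move=> /setD1P[nK K'T]; rewrite s12 -setI_eq0 -subset0.
  apply/subsetP => x /setIP[xK' /setUP[/setDP[xK _]|xX]].
    have /(_ K' K) := dT; move=> /(_ K'T KT nK); rewrite -setI_eq0 => /eqP E.
    by rewrite -E inE xK'.
  move: dX; rewrite -setI_eq0 => /eqP <-.
  by rewrite inE xX (subsetP (sub_cov K'T)).
have disj1 K' : K' \in T :\ K -> [disjoint supp K' & supp K1].
  by move/disj/disjointWr; apply; apply: subsetUl.
have disj2 K' : K' \in T :\ K -> [disjoint supp K' & supp K2].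
  by move/disj/disjointWr; apply; apply: subsetUr.
split; first split.
- by move=> K' /setU1P[->//|/setU1P[->//|/setD1P[_ /hT]]].
- move=> A B /setU1P[->|/setU1P[->|hA]] /setU1P[->|/setU1P[->|hB]];
    rewrite ?eqxx // => nAB.
  + by rewrite disjoint_sym disj1.
  + by rewrite disjoint_sym.
  + by rewrite disjoint_sym disj2.
  + exact: disj1.
  + exact: disj2.
  + by move: hA hB => /setD1P[_ hA] /setD1P[_ hB]; apply: dT.
- rewrite /cov 2!bigcup_setU !big_set1 setUA s12.
  have -> : \bigcup_(K0 in T :\ K) supp K0 = cov T :\: supp K.
    apply/setP => x; apply/bigcupP/setDP => [[K' /setD1P[nK K'T] xK']|].
      split; first by apply: (subsetP (sub_cov K'T)).
      apply/negP => xK; have := dT _ _ K'T KT nK.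
      by rewrite -setI_eq0 => /eqP/setP/(_ x); rewrite !inE xK' xK.
    move=> [/bigcupP[K' K'T xK'] xK]; exists K' => //; rewrite !inE K'T andbT.
    by apply: contraNneq xK => <-.
  apply/setP => x; rewrite !inE; have := subsetP sY x.
  have := subsetP (sub_cov KT) x.
  case: (x \in Y); case: (x \in supp K); case: (x \in X); case: (x \in cov T) => //=.
  - by move=> _ /(_ isT).
  - by move=> /(_ isT).
Qed.

(* The vertices of [X] are put into class [j] of the part [K1] cut off [K], in
   exchange for [Y]; the loss of [xi] in the balance of the two parts is due to
   rounding. *)
Lemma tile_step (al xi dl th ka : R) K (X Y P : {set V}) j :
  multipartite e K -> (forall i, #|K i|%:R <= al * #|supp K|%:R) ->
  0 < dl <= 2^-1 -> 0 <= al <= 1 -> 0 < xi <= 1 -> 0 < ka ->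
  ka <= dl * th -> ka <= dl -> 
  2 * r%:R <= xi * dl * #|supp K|%:R ->  2 <= xi * #|supp K|%:R ->
  [disjoint X & supp K] -> #|X|%:R <= ka * #|supp K|%:R ->
  (forall x y, x \in X -> y \in P -> e x y) ->
  (forall i, i != j -> dl * #|K i|%:R <= #|K i :&: P|%:R) ->
  Y \subset K j ->
  (Y = set0 /\ #|K j|%:R <= (al - th) * #|supp K|%:R) \/
  (#|Y| = #|X| /\ #|X|%:R + 1 <= dl * #|K j|%:R) ->
  exists K1 K2 : tile,
    [/\ multipartite e K1 /\ multipartite e K2,
        (forall i, #|K1 i|%:R <= (al + xi) * #|supp K1|%:R) /\
        (forall i, #|K2 i|%:R <= (al + xi) * #|supp K2|%:R),
        [disjoint supp K1 & supp K2] /\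
        supp K1 :|: supp K2 = (supp K :\: Y) :|: X,
        dl * #|supp K|%:R - r%:R <= #|supp K1|%:R :> R /\ (#|supp K1| <= #|supp K|)%N &
        (1 - dl) * #|supp K|%:R <= #|supp K2|%:R :> R /\ (#|supp K2| <= #|supp K|)%N].
Proof.
move=> mK vK /andP[dl0 dl2] /andP[al0 al1] /andP[xi0 xi1] ka0 kadt kad big1 big2 dX cX XP hP sY hY.
set sz := #|supp K| in vK big1 big2 cX hY *.
pose d i := Num.truncn (dl * #|K i|%:R).
have dle i : (d i)%:R <= dl * #|K i|%:R :> R by rewrite truncn_le mulr_ge0 // ltW.
have dgt i : dl * #|K i|%:R < (d i)%:R + 1 :> R.
  by rewrite natr1 truncnS_gt.
have dK i : (d i <= #|K i|)%N.
  rewrite -(ler_nat R) (le_trans (dle i)) // ler_piMl //; lra.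
(* Off class [j] the part cut off lies in [P], where it is joined to [X]. In class [j] it contains
   [Y]; there is room because [#|Y| + 1] is at most [dl * #|K j|] unless [Y] is empty. *)
have : forall i, exists C : {set V}, [/\ C \subset K i, #|C| = d i,
    (i != j -> C \subset P) & (i = j -> Y \subset C)].
  move=> i; have [->|nij] := eqVneq i j.
    have [|C [YC CK cC]] := @exists_between_card _ Y (K j) (d j) sY; last by exists C.
    rewrite dK andbT; case: hY => [[-> _]|[-> hX]]; first by rewrite cards0.
    by rewrite -ltnS -(ltr_nat R) -natr1; have := dgt j; lra.
  have [|C sC cC] := @exists_subset_card _ (K i :&: P) (d i).
    by rewrite -(ler_nat R) (le_trans (dle i)) ?hP.
  exists C; split=> // [||E]; last by rewrite E eqxx in nij.
    exact: subset_trans sC (subsetIl _ _).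
  by move=> _; apply: subset_trans sC (subsetIr _ _).
move/(@fin_all_exists _ _) => [C hC].
have CK i : C i \subset K i by case: (hC i).
have cC i : #|C i| = d i by case: (hC i).
have CP i : i != j -> C i \subset P by case: (hC i).
have YC : Y \subset C j by case: (hC j) => _ _ _; apply.
pose K1 : tile := [ffun i => if i == j then (C j :\: Y) :|: X else C i].
pose K2 : tile := [ffun i => K i :\: C i].
have dXK i : [disjoint X & K i] by apply: disjointWr dX; apply: sub_supp.
have dXC i : [disjoint X & C i] by apply: disjointWr (dXK i).
have mK1 : multipartite e K1.
  move=> i i' x y nii'; rewrite !ffunE.
  case: eqVneq => [Ei|ni]; case: eqVneq => [Ei'|ni'].
  - by rewrite Ei Ei' eqxx in nii'.
  - move=> /setUP[/setDP[xC _]|xX] yC.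
      by apply: (mK i i'); [|rewrite Ei|]; rewrite // (subsetP (CK _)).
    by apply: XP; rewrite // (subsetP (CP _ ni')).
  - move=> xC /setUP[/setDP[yC _]|yX].
      by apply: (mK i i'); [| |rewrite Ei']; rewrite // (subsetP (CK _)).
    by rewrite e_sym; apply: XP; rewrite // (subsetP (CP _ ni)).
  - by move=> xC yC; apply: (mK i i') => //; apply: (subsetP (CK _)).
have mK2 : multipartite e K2.
  by apply: multipartite_sub mK => i; rewrite ffunE subsetDl.
have c1j : #|K1 j| = (d j - #|Y| + #|X|)%N.
  rewrite ffunE eqxx cardsU (_ : (_ :&: X) = set0) ?cards0 ?subn0; last first.
    apply/eqP; rewrite setI_eq0 disjoint_sym.
    by apply: disjointWr (dXC j); apply: subsetDl.
  by rewrite cardsD (setIidPr YC) cC.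
have cYd : (#|Y| <= d j)%N by rewrite -cC subset_leq_card.
have c1i i : i != j -> #|K1 i| = d i by rewrite ffunE => /negbTE ->.
have cXR : 0 <= #|X|%:R :> R by [].
have szge0 : 0 <= sz%:R :> R by [].
have alsz : 0 <= al * sz%:R :> R by rewrite mulr_ge0.
have dale i : dl * #|K i|%:R <= dl * al * sz%:R.
  by rewrite -mulrA ler_wpM2l // ltW.
(* If [X] is added without exchange, the deficit [th] of class [j], scaled by [dl], absorbs the
   [ka * sz] new vertices. In an exchange the size of the part does not change. *)
have up1 i : #|K1 i|%:R <= dl * al * sz%:R.
  have [->|nij] := eqVneq i j; last by rewrite c1i // (le_trans (dle i)).
  rewrite c1j; case: hY => [[Y0 hj]|[EY _]]; last first.
    by rewrite -EY subnK // (le_trans (dle j)).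
  rewrite Y0 cards0 subn0 natrD.
  have h1 := dle j.
  have h2 : dl * #|K j|%:R <= dl * ((al - th) * sz%:R) by rewrite ler_wpM2l // ltW.
  have h3 : ka * sz%:R <= dl * th * sz%:R by rewrite ler_wpM2r.
  nra.
have lo1 i : dl * #|K i|%:R - 1 <= #|K1 i|%:R.
  have [->|nij] := eqVneq i j; last by rewrite c1i //; have := dgt i; lra.
  have hd := dgt j.
  suff : (d j)%:R <= #|K1 j|%:R :> R by lra.
  rewrite ler_nat c1j; case: hY => [[-> _]|[<- _]]; first by rewrite cards0 subn0 leq_addr.
  by rewrite subnK.
have szE : sz%:R = \sum_i #|K i|%:R :> R by rewrite /sz (card_supp e_irr mK) natr_sum.
have sz1E : #|supp K1|%:R = \sum_i #|K1 i|%:R :> R by rewrite (card_supp e_irr mK1) natr_sum.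
have sz2E : #|supp K2|%:R = \sum_i #|K2 i|%:R :> R by rewrite (card_supp e_irr mK2) natr_sum.
have c2 i : #|K2 i|%:R = #|K i|%:R - (d i)%:R :> R.
  by rewrite ffunE cardsD (setIidPr (CK i)) cC natrB.
have lo1s : dl * sz%:R - r%:R <= #|supp K1|%:R :> R.
  rewrite sz1E szE mulr_sumr -[X in X%:R]card_ord -sumr_const -sumrB.
  by apply: ler_sum => i _; apply: lo1.
have lo2s : (1 - dl) * sz%:R <= #|supp K2|%:R :> R.
  rewrite sz2E szE mulr_sumr; apply: ler_sum => i _; rewrite c2.
  have := dle i; lra.
have E12 : supp K1 :|: supp K2 = (supp K :\: Y) :|: X.
  apply/setP => x; apply/setUP/setUP.
    case=> /bigcupP[i _]; rewrite ffunE.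
      case: eqP => [_|/eqP nij].
        move=> /setUP[/setDP[xC xY]|xX]; last by right.
        by left; rewrite inE xY (mem_supp (i := j)) ?(subsetP (CK j)).
      move=> xC; left; have xK := subsetP (CK _) _ xC.
      rewrite inE (mem_supp xK) andbT; apply/negP => /(subsetP sY) xj.
      by have := mK _ _ _ _ nij xK xj; rewrite e_irr.
    move=> /setDP[xK xC]; left; rewrite inE (mem_supp xK) andbT.
    apply/negP => xY; have xj := subsetP sY _ xY.
    have [Ei|nij] := eqVneq i j; first by rewrite Ei (subsetP YC) in xC.
    by have := mK _ _ _ _ nij xK xj; rewrite e_irr.
  case=> [/setDP[/bigcupP[i _ xK] xY]|xX]; last first.
    by left; apply: (mem_supp (i := j)); rewrite ffunE eqxx inE xX orbT.
  have [xC|xC] := boolP (x \in C i); last first.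
    by right; apply: (mem_supp (i := i)); rewrite ffunE inE xC xK.
  left; apply: (mem_supp (i := i)); rewrite ffunE.
  by case: eqP => [Ei|//]; rewrite -Ei !inE xC xY.
have d12 : [disjoint supp K1 & supp K2].
  rewrite -setI_eq0 -subset0; apply/subsetP => x /setIP[/bigcupP[i _]].
  move=> + /bigcupP[i' _].
  rewrite !ffunE => x1 /setDP[x2 x2C].
  have : (x \in C i) || (x \in X).
    by move: x1; case: eqP => [->|_ ->//] /setUP[/setDP[->]|->]; rewrite ?orbT.
  case/orP => [xC|xX]; last first.
    by have := dXK i'; rewrite -setI_eq0 => /eqP <-; rewrite inE xX x2.
  have [Ei|nij] := eqVneq i i'; first by rewrite -Ei xC in x2C.
  by have := mK _ _ _ _ nij (subsetP (CK _) _ xC) x2; rewrite e_irr.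
have cYK : (#|Y| <= sz)%N by apply: subset_leq_card (subset_trans sY (sub_supp _ _)).
have c12 : (#|supp K1| + #|supp K2| <= sz + #|X|)%N.
  rewrite -cardsUI E12 (_ : supp K1 :&: supp K2 = set0); last by apply/eqP; rewrite setI_eq0.
  rewrite cards0 addn0 (leq_trans (leq_card_setU _ _)) // leq_add2r.
  by rewrite subset_leq_card ?subsetDl.
have c12R : #|supp K1|%:R + #|supp K2|%:R <= sz%:R + #|X|%:R :> R.
  by rewrite -!natrD ler_nat.
have hka : ka * sz%:R <= dl * sz%:R by rewrite ler_wpM2r.
have hdl : dl * sz%:R <= 2^-1 * sz%:R by rewrite ler_wpM2r.
(* In [K1] the term [xi * dl * sz] pays for the at most [r] vertices lost by rounding; in [K2] half
   of [xi * sz] pays for one vertex per class. By [c12R] and [lo2s], [K1] has at most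
   [(dl + ka) * sz] vertices, hence at most [sz]. *)
exists K1, K2; split=> //; split=> //.
- move=> i; apply: le_trans (up1 i) _.
  have : (al + xi) * (dl * sz%:R - r%:R) <= (al + xi) * #|supp K1|%:R.
    by rewrite ler_wpM2l // addr_ge0 // ltW.
  have : (al + xi) * r%:R <= 2 * r%:R by rewrite ler_wpM2r //; lra.
  lra.
- move=> i.
  have : (al + xi) * ((1 - dl) * sz%:R) <= (al + xi) * #|supp K2|%:R.
    by rewrite ler_wpM2l // addr_ge0 // ltW.
  rewrite c2; have := dgt i; have := vK i => h1 h2 h3.
  have : (1 - dl) * #|K i|%:R <= (1 - dl) * (al * sz%:R) by rewrite ler_wpM2l //; lra.
  have : xi * dl * sz%:R <= 2^-1 * (xi * sz%:R).
    by rewrite (mulrC xi) -mulrA ler_wpM2r // mulr_ge0 // ltW.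
  lra.
- rewrite -(ler_nat R) -/sz; lra.
- by apply: subset_leq_card; apply: supp_sub => i; rewrite ffunE subsetDl.
Qed.
End Step.

(** * Vertices for which few tiles admit a move *)

Section Stuck.
Variables (R : realType) (r : nat) (V : finType) (e : rel V).
Hypotheses (r_gt1 : (1 < r)%N) (e_irr : irreflexive e).
Variables (a s : R).
Hypotheses (s_gt0 : 0 < s) (le_s_a : s <= a) (asE : (r%:R - 1) * a + s = 1).
Local Notation tile := {ffun 'I_r -> {set V}}.
Implicit Types (K : tile) (T : {set tile}) (W : {set V}).

Definition nbh x := [set y | e x y].
Definition dg W x := #|W :&: nbh x|.
Definition low W (D : R) := [set y in W | (dg W y)%:R <= D].

(* The two cases stand for a minimum: z vertices of degree at most D force
   D >= (1 - a - s) |W| + (s / a) min(z, a |W|), here with slack [ga * |W|]. *)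
Definition degree_cond W (ga : R) :=
  forall D : R, (exists2 x, x \in W & (dg W x)%:R <= D) ->
    (r%:R - 2) * a * #|W|%:R + s / a * #|low W D|%:R + ga * #|W|%:R <= D \/
    (1 - a) * #|W|%:R + ga * #|W|%:R <= D.

Definition high W (ze : R) x := [set y | (dg W x)%:R + ze * #|W|%:R < (dg W y)%:R].

(* The threshold in the last line is the number of vertices moved at a time. *)
Definition improving W (al th ze dl ka : R) K x :=
  [exists j, [forall i, (i != j) ==> (dl * #|K i|%:R <= #|K i :&: nbh x|%:R)] &&
    ((#|K j|%:R <= (al - th) * #|supp K|%:R) ||
     (Num.truncn (ka * #|supp K|%:R) <= #|K j :&: high W ze x|)%N)].

Lemma a_gt0 : 0 < a. Proof. exact: lt_le_trans s_gt0 le_s_a. Qed.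

Lemma r2a : (r%:R - 2) * a = 1 - a - s.
Proof. have := asE; lra. Qed.

(** The other [r - 1] classes together hold at most the proportion [1 - s / 2] of the tile. *)
Lemma class_ge (al : R) K j : multipartite e K ->
  (forall i, #|K i|%:R <= al * #|supp K|%:R) -> (r%:R - 1) * al <= 1 - s / 2 ->
  s / 2 * #|supp K|%:R <= #|K j|%:R.
Proof.
move=> mK vK hal.
have : #|supp K|%:R = \sum_i #|K i|%:R :> R by rewrite (card_supp e_irr mK) natr_sum.
rewrite (bigD1 j) //=.
have : \sum_(i < r) al * #|supp K|%:R = r%:R * (al * #|supp K|%:R).
  by rewrite sumr_const card_ord mulr_natl.
rewrite (bigD1 j) //=.
have : \sum_(i < r | i != j) #|K i|%:R <= \sum_(i < r | i != j) al * #|supp K|%:R.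
  by apply: ler_sum.
have : (r%:R - 1) * (al * #|supp K|%:R) <= (1 - s / 2) * #|supp K|%:R.
  by rewrite mulrA ler_wpM2r.
lra.
Qed.

(** Say that [x] misses a class if it has less than the proportion [dl] of neighbours in it. If it
    misses two classes, neighbours essentially come from [r - 2] classes of proportion about [a]. If
    it misses only [K j], the absence of a move makes [K j] larger than [a * sz] and almost free of
    vertices in [high]; then the term with [s / a] contributes about [s], and
    [(r - 2) * a + s = 1 - a]. It cannot miss no class at all. *)
Lemma stuck_tile W (al th ze dl ka rho : R) K x :
  supp K \subset W -> multipartite e K ->
  (forall i, #|K i|%:R <= al * #|supp K|%:R) ->
  a + th <= al <= a + rho -> 0 <= th -> 0 < dl <= 1 -> 0 < ka ->
  ~~ improving W al th ze dl ka K x ->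
  #|nbh x :&: supp K|%:R <= ((r%:R - 2) * a + (dl + ka + (r%:R - 2) * rho)) * #|supp K|%:R
     + s / a * #|low W ((dg W x)%:R + ze * #|W|%:R) :&: supp K|%:R /\
  #|nbh x :&: supp K|%:R <= (1 - a + (dl + ka + (r%:R - 2) * rho)) * #|supp K|%:R :> R.
Proof.
move=> sK mK vK /andP[al1 al2] th0 /andP[dl0 dl1] ka0 nI.
have a0 := a_gt0; have s0 := s_gt0; have sa := le_s_a; have asE' := asE.
have r2 : 2 <= r%:R :> R by rewrite ler_nat.
set sz := #|supp K| in vK *.
have sz0 : 0 <= sz%:R :> R by [].
pose n i : R := #|K i|%:R.
pose b i : R := #|K i :&: nbh x|%:R.
have n0 i : 0 <= n i by [].
have b0 i : 0 <= b i by [].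
have bn i : b i <= n i by rewrite ler_nat subset_leq_card ?subsetIl.
have vKn i : n i <= al * sz%:R by apply: vK.
have szE : sz%:R = \sum_i n i by rewrite /sz (card_supp e_irr mK) natr_sum.
have BE : #|nbh x :&: supp K|%:R = \sum_i b i.
  rewrite (card_setI_supp e_irr _ mK) natr_sum; apply: eq_bigr => i _.
  by rewrite setIC.
have rho0 : 0 <= rho by lra.
have rrho : 0 <= (r%:R - 2) * rho by rewrite mulr_ge0 // subr_ge0.
have Z0 : 0 <= s / a * #|low W ((dg W x)%:R + ze * #|W|%:R) :&: supp K|%:R.
  by rewrite mulr_ge0 // divr_ge0 // ltW.
have kasz : 0 <= ka * sz%:R by rewrite mulr_ge0 // ltW.
have dlsz : 0 <= dl * sz%:R by rewrite mulr_ge0 // ltW.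
rewrite BE.
have [/existsP[i /existsP[j /and3P[nij mi mj]]]|] := boolP [exists i, exists j,
    [&& i != j, b i < dl * n i & b j < dl * n j]].
  have E1 : \sum_k b k <= dl * (n i + n j) + \sum_(k | (k != i) && (k != j)) n k.
    rewrite (bigD1 i) //= (bigD1 j) 1?eq_sym //= addrA lerD //; first lra.
    by apply: ler_sum.
  have E2 : \sum_(k | (k != i) && (k != j)) n k <= (r%:R - 2) * (al * sz%:R).
    have : \sum_(k < r) al * sz%:R = r%:R * (al * sz%:R).
      by rewrite sumr_const card_ord mulr_natl.
    rewrite (bigD1 i) //= (bigD1 j) 1?eq_sym //= => E.
    have : \sum_(k | (k != i) && (k != j)) n k <= \sum_(k | (k != i) && (k != j)) al * sz%:R.
      by apply: ler_sum.
    lra.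
  have E3 : n i + n j <= sz%:R.
    rewrite szE (bigD1 i) //= (bigD1 j) 1?eq_sym //= addrA lerDl.
    by apply: sumr_ge0.
  have E4 : dl * (n i + n j) <= dl * sz%:R by rewrite ler_wpM2l // ltW.
  have E5 : (r%:R - 2) * (al * sz%:R) <= (r%:R - 2) * ((a + rho) * sz%:R).
    by rewrite ler_wpM2l ?subr_ge0 // ler_wpM2r.
  have E6 : (r%:R - 2) * a * sz%:R = (1 - a - s) * sz%:R by rewrite r2a.
  have E7 : s * sz%:R >= 0 by rewrite mulr_ge0 // ltW.
  split; lra.
move=> /existsPn nomiss.
have [/existsP[j mj]|/existsPn nm] := boolP [exists j, b j < dl * n j].
  have hO i : i != j -> dl * n i <= b i.
    move=> nij; rewrite leNgt; apply/negP => mi; have := nomiss i.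
    by move=> /existsPn/(_ j); rewrite nij mi mj.
  move: nI; rewrite /improving => /existsPn/(_ j); rewrite negb_and.
  case/orP => [/negP[]|].
    by apply/forallP => i; apply/implyP; apply: hO.
  rewrite negb_or -ltNge -ltnNge => /andP[nj hj].
  have nja : a * sz%:R <= n j.
    apply: le_trans (ltW nj); rewrite ler_wpM2r //; lra.
  have hj' : #|K j :&: high W ze x|%:R <= ka * sz%:R.
    apply: le_trans (_ : (Num.truncn (ka * sz%:R))%:R <= _).
      by rewrite ler_nat ltnW.
    by rewrite truncn_le.
  have E1 : \sum_k b k <= sz%:R - (1 - dl) * n j.
    have : \sum_(k | k != j) b k <= \sum_(k | k != j) n k by apply: ler_sum.
    have : sz%:R = n j + \sum_(k | k != j) n k by rewrite szE (bigD1 j).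
    have : \sum_k b k = b j + \sum_(k | k != j) b k by rewrite (bigD1 j).
    lra.
  have E2 : (1 - dl) * (a * sz%:R) <= (1 - dl) * n j by rewrite ler_wpM2l // subr_ge0.
  have a1 : a <= 1.
    have : 0 <= (r%:R - 2) * a by rewrite mulr_ge0 ?subr_ge0 // ltW.
    lra.
  have E3 : dl * (a * sz%:R) <= dl * sz%:R.
    by rewrite ler_wpM2l ?(ltW dl0) // ler_piMl.
  have E4 : (r%:R - 2) * a * sz%:R = (1 - a - s) * sz%:R by rewrite r2a.
  have E8 : 0 <= (r%:R - 2) * rho * sz%:R by rewrite mulr_ge0.
  split; last lra.
  set Z := low W _.
  have zK : n j - ka * sz%:R <= #|Z :&: supp K|%:R.
    have : n j <= #|Z :&: supp K|%:R + #|K j :&: high W ze x|%:R.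
      rewrite -natrD ler_nat (leq_trans _ (leq_card_setU _ _)) //.
      apply: subset_leq_card; apply/subsetP => y yj; rewrite !inE.
      rewrite yj (mem_supp yj) (subsetP sK _ (mem_supp yj)) /= andbT.
      by case: leP.
    lra.
  have E5 : s / a * (a * sz%:R - ka * sz%:R) <= s / a * #|Z :&: supp K|%:R.
    rewrite ler_wpM2l ?divr_ge0 ?(ltW a0) ?(ltW s_gt0) //; lra.
  have E6 : s / a * (ka * sz%:R) <= ka * sz%:R.
    by rewrite ler_piMl // ler_pdivrMr // mul1r.
  have E7 : s / a * (a * sz%:R) = s * sz%:R by field; rewrite gt_eqF.
  lra.
(* Since [r * a] is at least 1, some class has proportion at most [a]; with no class missed, that
   class could be enlarged. *)
have [j hj] : exists j, n j <= a * sz%:R.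
  apply/existsP; apply: contraT => /existsPn hn.
  have : \sum_(k < r) a * sz%:R < \sum_k n k.
    apply: ltr_sum => [|k _]; first by apply/hasP; exists (Ordinal r_gt1); rewrite ?mem_index_enum.
    by rewrite ltNge.
  rewrite -szE sumr_const card_ord -mulr_natl.
  have : (r%:R * a - 1) * sz%:R >= 0 by rewrite mulr_ge0 //; lra.
  lra.
move: nI; rewrite /improving => /existsPn/(_ j); rewrite negb_and negb_or.
case/orP => [/negP[]|/andP[/negP[]]].
  by apply/forallP => i; apply/implyP => _; have := nm i; rewrite -leNgt.
apply: le_trans hj _; rewrite ler_wpM2r //; lra.
Qed.

(** The neighbours of [x] are uncovered, or in tiles admitting a move, which are bounded by their
    full size, or in other tiles, which are bounded by [stuck_tile]. The degree condition at
    [dg W x + ze * #|W|] then forces the second kind to be large. *)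
Lemma improving_mass W (al th ze dl ka rho ga : R) t t0 T x :
  tiling e W al t t0 T -> degree_cond W ga -> x \in W ->
  a + th <= al <= a + rho -> 0 <= th -> 0 < dl <= 1 -> 0 < ka -> 0 <= ze ->
  (ga - (dl + ka + (r%:R - 2) * rho) - ze) * #|W|%:R - #|W :\: cov T|%:R
    <= \sum_(K in T | improving W al th ze dl ka K x) #|supp K|%:R.
Proof.
move=> hT hD xW al12 th0 dl01 ka0 ze0.
have [al1 al2] := andP al12.
have [dl0 dl1] := andP dl01.
have a0 := a_gt0; have s0 := s_gt0; have sa := le_s_a; have asE' := asE.
have r2 : 2 <= r%:R :> R by rewrite ler_nat.
set err := dl + ka + _; set N : R := #|W|%:R.
have err0 : 0 <= err.
  by rewrite !addr_ge0 ?(ltW ka0) ?(ltW dl0) // mulr_ge0 ?subr_ge0 //; lra.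
set D := (dg W x)%:R + ze * N.
set m := \sum_(K in T | _) _.
have N0 : 0 <= N by [].
have zeN : 0 <= ze * N by rewrite mulr_ge0.
have errN : 0 <= err * N by rewrite mulr_ge0.
have covW : #|cov T|%:R <= N by rewrite ler_nat subset_leq_card ?(cov_sub hT).
have covE : #|cov T|%:R = \sum_(K in T) #|supp K|%:R :> R.
  by rewrite (card_cov hT) natr_sum.
have dgE : (dg W x)%:R <= #|W :\: cov T|%:R + \sum_(K in T) #|nbh x :&: supp K|%:R :> R.
  rewrite -natr_sum -(card_setI_cov _ hT) -natrD ler_nat.
  rewrite (leq_trans _ (leq_card_setU _ _)) // subset_leq_card //.
  apply/subsetP => y; rewrite !inE => /andP[-> ->]; by case: (y \in cov T).
have zE : \sum_(K in T) #|low W D :&: supp K|%:R <= #|low W D|%:R :> R.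
  by rewrite -natr_sum -(card_setI_cov _ hT) ler_nat subset_leq_card ?subsetIl.
have b1 : \sum_(K in T) #|nbh x :&: supp K|%:R <=
    m + ((r%:R - 2) * a + err) * N + s / a * #|low W D|%:R.
  apply: le_trans (_ : m + \sum_(K in T) (((r%:R - 2) * a + err) * #|supp K|%:R
     + s / a * #|low W D :&: supp K|%:R) <= _); last first.
    rewrite big_split /= -!mulr_sumr -covE.
    have : ((r%:R - 2) * a + err) * #|cov T|%:R <= ((r%:R - 2) * a + err) * N.
      rewrite ler_wpM2l // addr_ge0 // mulr_ge0 ?subr_ge0 // ltW //.
    have : s / a * (\sum_(K in T) #|low W D :&: supp K|%:R) <= s / a * #|low W D|%:R.
      by rewrite ler_wpM2l // divr_ge0 // ltW.
    lra.
  rewrite (bigID (fun K => improving W al th ze dl ka K x)) /=.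
  rewrite [X in _ <= m + X](bigID (fun K => improving W al th ze dl ka K x)) /=.
  set S1 := (X in X + _ <= _).
  have h1 : S1 <= m.
    by apply: ler_sum => K _; rewrite ler_nat subset_leq_card ?subsetIr.
  rewrite addrA lerD //.
    rewrite -[S1]addr0 lerD // sumr_ge0 // => K _; rewrite addr_ge0 // mulr_ge0 //.
      by rewrite addr_ge0 // mulr_ge0 ?subr_ge0 // ltW.
    by rewrite divr_ge0 // ltW.
  apply: ler_sum => K /andP[KT nI].
  have [h _] := hT; have [sK mK vK _] := h _ KT.
  by have [] := stuck_tile sK mK vK al12 th0 dl01 ka0 nI.
have b2 : \sum_(K in T) #|nbh x :&: supp K|%:R <= m + (1 - a + err) * N.
  have a1 : a <= 1.
    have : 0 <= (r%:R - 2) * a by rewrite mulr_ge0 ?subr_ge0 // ltW.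
    lra.
  apply: le_trans (_ : m + \sum_(K in T) ((1 - a + err) * #|supp K|%:R) <= _); last first.
    rewrite -!mulr_sumr -covE lerD2l ler_wpM2l // addr_ge0 // subr_ge0 //.
  rewrite (bigID (fun K => improving W al th ze dl ka K x)) /=.
  rewrite [X in _ <= m + X](bigID (fun K => improving W al th ze dl ka K x)) /=.
  set S1 := (X in X + _ <= _).
  have h1 : S1 <= m.
    by apply: ler_sum => K _; rewrite ler_nat subset_leq_card ?subsetIr.
  rewrite addrA lerD //.
    rewrite -[S1]addr0 lerD // sumr_ge0 // => K _; rewrite mulr_ge0 //.
    by rewrite addr_ge0 // subr_ge0.
  apply: ler_sum => K /andP[KT nI].
  have [h _] := hT; have [sK mK vK _] := h _ KT.
  by have [] := stuck_tile sK mK vK al12 th0 dl01 ka0 nI.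
(* [b1] answers the first alternative of [degree_cond], [b2] the second. *)
have : exists2 x, x \in W & (dg W x)%:R <= D by exists x => //; rewrite /D; lra.
have DE : D = (dg W x)%:R + ze * N by [].
clearbody D; by move=> /hD[]; rewrite -/N; lra.
Qed.
End Stuck.

(** * One round of moves *)

Lemma pigeonhole (T U : finType) (X : {set T}) (A : {set U}) (f : T -> U) l :
  (forall x, x \in X -> f x \in A) -> (#|A| * l < #|X|)%N ->
  exists p, (l <= #|[set x in X | f x == p]|)%N.
Proof.
move=> fA; rewrite ltnNge => hX; apply/existsP; apply: contraNT hX => /existsPn hl.
rewrite -sum1_card (partition_big f (mem A)) //= -sum_nat_const.
apply: leq_sum => p _; rewrite sum1dep_card ltnW //.
by rewrite ltnNge; apply: hl.
Qed.

Section Round.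
Variables (R : realType) (r : nat) (V : finType) (e : rel V).
Hypotheses (r_gt1 : (1 < r)%N) (e_sym : symmetric e) (e_irr : irreflexive e).
Variables (a s : R).
Hypotheses (s_gt0 : 0 < s) (le_s_a : s <= a) (asE : (r%:R - 1) * a + s = 1).
Local Notation tile := {ffun 'I_r -> {set V}}.
Implicit Types (K : tile) (T : {set tile}) (W : {set V}).

(** The factor 2 keeps all weights between 1/2 and 1, so that [Psi] and the number of uncovered
    vertices agree up to a factor 2. *)
Definition cost W x : R := 1 - (dg e W x)%:R / (2 * #|W|%:R).
Definition Psi W T : R := \sum_(x in W :\: cov T) cost W x.

Lemma cost_bounds W x : 2^-1 <= cost W x <= 1.
Proof.
(* For empty [W] the quotient is 0 by convention and the cost is 1. *)
rewrite /cost; have [W0|W0] := posnP #|W|.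
  by rewrite W0 mulr0 invr0 mulr0 subr0 lexx andbT; lra.
have W1 : 0 < #|W|%:R :> R by rewrite ltr0n.
have : 0 <= (dg e W x)%:R / (2 * #|W|%:R) :> R by rewrite divr_ge0 // mulr_ge0.
have : (dg e W x)%:R / (2 * #|W|%:R) <= 2^-1 :> R.
  rewrite ler_pdivrMr ?mulr_gt0 // mulKf ?pnatr_eq0 // ler_nat.
  by rewrite subset_leq_card ?subsetIl.
lra.
Qed.

Lemma Psi_le W T : Psi W T <= #|W :\: cov T|%:R.
Proof.
rewrite -sum1_card natr_sum; apply: ler_sum => x _.
by case/andP: (cost_bounds W x).
Qed.

Lemma Psi_ge W T : #|W :\: cov T|%:R <= 2 * Psi W T.
Proof.
rewrite -sum1_card natr_sum mulr_sumr; apply: ler_sum => x _.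
by case/andP: (cost_bounds W x); lra.
Qed.

Lemma Psi_update W T T' (X Y : {set V}) :
  cov T' = (cov T :\: Y) :|: X -> X \subset W :\: cov T -> Y \subset cov T ->
  Y \subset W ->
  Psi W T' = Psi W T - \sum_(x in X) cost W x + \sum_(y in Y) cost W y.
Proof.
move=> cT' sX sY YW; rewrite /Psi.
have -> : W :\: cov T' = (W :\: cov T :\: X) :|: Y.
  apply/setP => x; rewrite cT' !inE.
  move: (introT implyP (subsetP sX x)) (introT implyP (subsetP sY x)).
  move: (introT implyP (subsetP YW x)); rewrite !inE.
  by case: (x \in X); case: (x \in Y); case: (x \in W); case: (x \in cov T).
rewrite [X in _ = X - _ + _](big_setID X) /= (setIidPr sX).
have dXY : [disjoint W :\: cov T :\: X & Y].
  rewrite -setI_eq0 -subset0; apply/subsetP => x /setIP[].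
  by rewrite !inE => /andP[_ /andP[/negP nc _]] /(subsetP sY).
rewrite (eq_bigl [predU W :\: cov T :\: X & Y]) => [|x]; last by rewrite !inE.
rewrite bigU //=; lra.
Qed.

(** Every vertex of [Y] costs at least [ze / 2] less than every vertex of [X]. Summing over all
    pairs and dividing by [#|X|] avoids the choice of a bijection. *)
Lemma swap_gain W (ze : R) (X Y : {set V}) :
  #|Y| = #|X| -> (0 < #|X|)%N -> Y \subset W ->
  (forall x, x \in X -> Y \subset high e W ze x) ->
  \sum_(y in Y) cost W y - \sum_(x in X) cost W x <= - (ze / 2 * #|X|%:R).
Proof.
move=> cY X0 YW XY.
have cYX x y : x \in X -> y \in Y -> cost W y <= cost W x - ze / 2.
  move=> xX yY; have := subsetP (XY x xX) _ yY; rewrite inE => h.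
  have W0 : 0 < #|W|%:R :> R.
    by rewrite ltr0n card_gt0; apply/set0Pn; exists y; apply: (subsetP YW).
  set N : R := #|W|%:R in h W0 *.
  have h1 : ((dg e W x)%:R + ze * N) / (2 * N) <= (dg e W y)%:R / (2 * N).
    by rewrite ler_pM2r ?invr_gt0 ?mulr_gt0 // ltW.
  have h2 : ((dg e W x)%:R + ze * N) / (2 * N) = (dg e W x)%:R / (2 * N) + ze / 2.
    by field; rewrite gt_eqF.
  rewrite /cost -/N; lra.
have dbl : \sum_(x in X) \sum_(y in Y) cost W y <=
    \sum_(x in X) \sum_(y in Y) (cost W x - ze / 2).
  by apply: ler_sum => x xX; apply: ler_sum => y yY; apply: cYX.
have e1 : \sum_(x in X) \sum_(y in Y) cost W y = #|X|%:R * \sum_(y in Y) cost W y.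
  by rewrite sumr_const mulr_natl.
have e2 : \sum_(x in X) \sum_(y in Y) (cost W x - ze / 2) =
    #|X|%:R * (\sum_(x in X) cost W x - #|X|%:R * (ze / 2)).
  transitivity (\sum_(x in X) #|X|%:R * (cost W x - ze / 2)).
    by apply: eq_bigr => x _; rewrite sumr_const cY mulr_natl.
  by rewrite -mulr_sumr sumrB sumr_const [#|X|%:R * (ze / 2)]mulr_natl.
rewrite e1 e2 ler_pM2l ?ltr0n // in dbl; lra.
Qed.

(** A vertex determines two subsets of [supp K], hence one of at most [4 ^ t0] patterns, and [l] is
    at most [t0]. *)
Lemma common_pattern W (ze : R) K t0 l (X0 : {set V}) :
  (#|supp K| <= t0)%N -> (0 < l <= #|supp K|)%N -> (4 ^ t0 * t0 < #|X0|)%N ->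
  exists2 X : {set V}, X \subset X0 /\ #|X| = l &
    exists2 x0, x0 \in X & forall x, x \in X ->
      nbh e x :&: supp K = nbh e x0 :&: supp K /\
      high e W ze x :&: supp K = high e W ze x0 :&: supp K.
Proof.
move=> Kt /andP[l0 lsz] hX0.
pose pat x := (nbh e x :&: supp K, high e W ze x :&: supp K).
have [||q hq] := @pigeonhole _ _ X0 (setX (powerset (supp K)) (powerset (supp K))) pat l.
- by move=> x _; rewrite in_setX !powersetE !subsetIr.
- apply: leq_ltn_trans hX0; rewrite cardsX card_powerset -expnMn leq_mul //.
    by rewrite leq_pexp2l.
  exact: leq_trans lsz Kt.
have [X sX cX] := exists_subset_card hq.
have Xq x : x \in X -> pat x = q by move/(subsetP sX); rewrite inE => /andP[_ /eqP].
exists X.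
  by split=> //; apply: subset_trans sX _; apply/subsetP => x; rewrite inE => /andP[].
have /set0Pn[x0 x0X] : X != set0 by rewrite -cards_eq0 cX -lt0n.
exists x0 => // x xX; have : pat x = pat x0 by rewrite !Xq.
by move=> [-> ->].
Qed.

Section Process.
(** Roles of the parameters: a move cuts off the proportion [dl] of a tile and brings in the
    proportion [ka]; [th] is the deficit of a class that may grow, [ze] the degree gain of an
    exchange, [xi] the loss of balance, [rho] a bound on [al - a], [ga] the slack of the degree
    condition, and [eta] the uncovered proportion above which a round is worthwhile. *)
Variables (W : {set V}) (al xi th ze dl ka rho ga eta : R) (t t1 t0 : nat) (T : {set tile}).
Hypotheses (hT : tiling e W al t1 t0 T) (hD : degree_cond r e a s W ga).
Hypotheses (al_lo : a + th <= al) (al_hi : al <= a + rho) (al1 : al <= 1)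
  (th0 : 0 < th) (dl0 : 0 < dl) (dl2 : dl <= 2^-1) (ka0 : 0 < ka)
  (ka_th : ka <= dl * th) (ka_s : ka <= dl * (s / 4)) (ze0 : 0 < ze) (ze1 : ze <= 1)
  (xi0 : 0 < xi) (xi1 : xi <= 1) (rho_s : (r%:R - 1) * rho <= s / 2)
  (err : dl + ka + (r%:R - 2) * rho + ze <= ga / 4).
Hypotheses (t1a : 2 * r%:R <= xi * dl * t1%:R) (t1b : 2 <= xi * t1%:R)
  (t1c : 2 <= ka * t1%:R) (t1d : t%:R + r%:R <= dl * t1%:R).
Hypotheses (N_big : 8 * (4 ^ t0 * t0)%:R < eta * ga * #|W|%:R)
  (ka_eta : ka <= eta / 2) (U_lo : eta * #|W|%:R <= #|W :\: cov T|%:R)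
  (U_hi : #|W :\: cov T|%:R <= ga / 4 * #|W|%:R) (ga0 : 0 < ga) (eta0 : 0 < eta).

Local Notation imp := (improving e W al th ze dl ka).
Local Notation mass Q := (\sum_(K in Q) #|supp K|%:R : R).

(* [T'] arises from [T] by moves in the tiles of [Q], each used once. *)
Definition state (Q T' : {set tile}) :=
  [/\ Q \subset T, T :\: Q \subset T', tiling e W (al + xi) t t0 T',
      Psi W T' <= Psi W T - ze * ka / 4 * mass Q &
      #|(W :\: cov T) :&: cov T'|%:R <= ka * mass Q].

(** Double counting: for each uncovered vertex the tiles outside [Q] with a move have mass at least
    [ga / 4 * #|W|]. If each such tile served at most [4 ^ t0 * t0] uncovered vertices, the total
    would contradict [N_big]. *)
Lemma many_improving Q T' : state Q T' -> mass Q < ga / 4 * #|W|%:R ->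
  exists2 K, K \in T :\: Q &
    (4 ^ t0 * t0 < #|[set x in (W :\: cov T) :\: cov T' | imp K x]|)%N.
Proof.
move=> [QT _ _ _ hU] hm.
move: (N_big) (U_lo) (U_hi) (err) (dl2) (ka_eta) (ka0) (ga0) (eta0).
move=> Nb Ul Uh er d2 kae k0 g0 et0.
set U0 := _ :\: cov T'.
set B := (4 ^ t0 * t0)%N in Nb *.
set N : R := #|W|%:R in Nb Ul Uh hm *.
have N0 : 0 <= N by [].
apply/exists_inP; apply: contraT => /exists_inPn hB.
have a0 : 0 < a := lt_le_trans s_gt0 le_s_a.
have hx x : x \in U0 -> ga / 4 * N <= \sum_(K in T :\: Q | imp K x) #|supp K|%:R.
  move=> /setDP[/setDP[xW _] _].
  have h01 : 0 < dl <= 1 by rewrite dl0; lra.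
  have hal : a + th <= al <= a + rho by rewrite al_lo.
  have := improving_mass r_gt1 e_irr s_gt0 le_s_a asE hT hD xW hal (ltW th0) h01 ka0 (ltW ze0).
  rewrite -/N.
  rewrite (bigID (mem Q)) /=.
  have : \sum_(K in T | imp K x && (K \in Q)) #|supp K|%:R <= mass Q.
    rewrite [X in _ <= X](bigID (fun K => imp K x)) /=.
    rewrite -[X in X <= _]addr0 lerD ?sumr_ge0 //.
    rewrite le_eqVlt; apply/orP; left; apply/eqP; apply: eq_bigl => K.
    case: (boolP (K \in Q)) => KQ; last by rewrite !andbF.
    by rewrite (subsetP QT) // andbT.
  have : (dl + ka + (r%:R - 2) * rho + ze) * N <= ga / 4 * N by rewrite ler_wpM2r.
  under [X in _ -> _ -> _ <= _ + X -> _]eq_bigl => K do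
    rewrite -andbA [imp K x && _]andbC andbA [(K \in T) && _]andbC -in_setD.
  under [X in _ -> _ -> _ <= X + _ -> _]eq_bigl => K do
    rewrite -andbA.
  lra.
(* The moves made so far have used at most [ka * mass Q] of the originally uncovered vertices, which
   is at most half of them. *)
have cU0 : eta / 2 * N <= #|U0|%:R.
  have E : #|W :\: cov T|%:R = #|(W :\: cov T) :&: cov T'|%:R + #|U0|%:R :> R.
    by rewrite -natrD cardsID.
  have hm1 : mass Q <= N.
    apply: le_trans (_ : mass T <= _).
      rewrite [X in _ <= X](big_setID Q) /= (setIidPr QT) lerDl; exact: sumr_ge0.
    by rewrite -natr_sum -(card_cov hT) ler_nat subset_leq_card ?(cov_sub hT).
  have : ka * mass Q <= eta / 2 * N.
    apply: le_trans (_ : ka * N <= _); first by rewrite ler_wpM2l // ltW.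
    by rewrite ler_wpM2r.
  by move: hU; lra.
have s1 : #|U0|%:R * (ga / 4 * N) <= \sum_(x in U0) \sum_(K in T :\: Q | imp K x) #|supp K|%:R.
  rewrite -sum1_card natr_sum mulr_suml; apply: ler_sum => x xU.
  by rewrite mul1r hx.
have s2 : \sum_(x in U0) \sum_(K in T :\: Q | imp K x) #|supp K|%:R <= B%:R * N.
  under eq_bigr => x _ do rewrite big_mkcondr.
  rewrite exchange_big /=.
  apply: le_trans (_ : \sum_(K in T :\: Q) B%:R * #|supp K|%:R <= _).
    apply: ler_sum => K KT; rewrite -big_mkcondr /= sumr_const -[X in X <= _]mulr_natl ler_wpM2r //.
    rewrite ler_nat; have := hB K KT; rewrite -leqNgt.
    apply: leq_trans; apply: subset_leq_card; apply/subsetP => x.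
    by rewrite unfold_in !inE.
  rewrite -mulr_sumr ler_wpM2l //.
  apply: le_trans (_ : mass T <= _).
    rewrite [X in _ <= X](big_setID Q) /= lerDr; exact: sumr_ge0.
  by rewrite -natr_sum -(card_cov hT) ler_nat subset_leq_card ?(cov_sub hT).
have s3 : eta / 2 * N * (ga / 4 * N) <= #|U0|%:R * (ga / 4 * N).
  by rewrite ler_wpM2r // mulr_ge0 // divr_ge0 // ltW.
have N1 : 0 < N.
  rewrite lt_neqAle N0 andbT eq_sym; apply/eqP => N1.
  by move: Nb; rewrite N1 mulr0 ltNge mulr_ge0.
have : N * (8 * B%:R) < N * (eta * ga * N) by rewrite ltr_pM2l.
have : N * (8 * B%:R) = 8 * (B%:R * N) by ring.
have : N * (eta * ga * N) = 8 * (eta / 2 * N * (ga / 4 * N)) by field.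
by move: s1 s2 s3; lra.
Qed.
Lemma state_step Q T' : state Q T' -> mass Q < ga / 4 * #|W|%:R ->
  exists K T'', K \in T :\: Q /\ state (K |: Q) T''.
Proof.
move=> hS hm; have [K KTQ hK] := many_improving hS hm.
case: hS => QT sT' hT' hPsi hU.
have [KT KQ] : K \in T /\ K \notin Q by move: KTQ => /setDP[].
have KT' : K \in T' by apply: (subsetP sT').
exists K.
have [hT1 _] := hT; have [sKW mK vK /andP[tK Kt]] := hT1 _ KT.
set sz := #|supp K| in vK tK Kt.
move: (dl2) (dl0) (ka0) (t1a) (t1b) (t1c) (t1d) (xi0) (xi1) (ka_s)
  (s_gt0) (le_s_a) (asE) (ze0) (ze1)
  => d2 d0 k0 ta tb tc td x0 x1 kas s0 sa asE' z0 z1.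
have sz1 : t1%:R <= sz%:R :> R by rewrite ler_nat.
have xd0 : 0 <= xi * dl by rewrite mulr_ge0 // ltW.
have big1 : 2 * r%:R <= xi * dl * sz%:R.
  by apply: le_trans ta _; rewrite ler_wpM2l.
have big2 : 2 <= xi * sz%:R by apply: le_trans tb _; rewrite ler_wpM2l // ltW.
have big3 : 2 <= ka * sz%:R by apply: le_trans tc _; rewrite ler_wpM2l // ltW.
have big4 : t%:R + r%:R <= dl * sz%:R by apply: le_trans td _; rewrite ler_wpM2l // ltW.
pose l := Num.truncn (ka * sz%:R).
have lle : l%:R <= ka * sz%:R by rewrite truncn_le mulr_ge0 // ltW.
have llt : ka * sz%:R < l%:R + 1 by rewrite natr1 truncnS_gt.
(* Since [ka * sz] is at least 2, rounding loses at most half of it. *)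
have kal : ka * sz%:R <= 2 * l%:R by lra.
have l1 : (0 < l)%N by rewrite -(ltr_nat R); lra.
have r2 : 2 <= r%:R :> R by rewrite ler_nat.
have a0 : 0 < a by apply: lt_le_trans sa.
have s1 : s <= 1.
  have : 0 <= (r%:R - 1) * a by rewrite mulr_ge0 ?ltW // subr_gt0; lra.
  lra.
have kadl : ka <= dl.
  have : dl * (s / 4) <= dl * 1 by rewrite ler_wpM2l ?ltW //; lra.
  lra.
have lsz : (l <= sz)%N.
  by rewrite -(ler_nat R) (le_trans lle) // ler_piMl //; lra.
set X0 := [set x in _ | _] in hK.
have hl : (0 < l <= sz)%N by rewrite l1.
(* All vertices of [X] see [K] as [x1'] does, so the move available for [x1'] can be made with the
   whole of [X]. *)
have [X [sX cX] [x1' x1X hX]] := common_pattern W ze Kt hl hK.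
have XX0 x : x \in X -> x \in X0 by apply: (subsetP sX).
have XW : X \subset W :\: cov T'.
  by apply/subsetP => x /XX0; rewrite !inE => /andP[/and3P[-> _ ->]].
have dX : [disjoint X & cov T'].
  rewrite -setI_eq0 -subset0; apply/subsetP => x /setIP[/(subsetP XW)].
  by rewrite inE => /andP[/negP].
have dXK : [disjoint X & supp K] by apply: disjointWr dX; apply: sub_cov.
have : imp K x1' by have := XX0 _ x1X; rewrite inE => /andP[].
move=> /existsP[j /andP[/forallP hP hj]].
set P := nbh e x1' :&: supp K.
have XP x y : x \in X -> y \in P -> e x y.
  by move=> xX; have [E _] := hX x xX; rewrite /P -E !inE => /andP[].
have hP' i : i != j -> dl * #|K i|%:R <= #|K i :&: P|%:R.
  move=> nij; have := hP i; rewrite nij /= => h; apply: le_trans h _.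
  rewrite ler_nat subset_leq_card //; apply/subsetP => y /setIP[yK yx].
  by rewrite !inE in yx *; rewrite yK yx (mem_supp yK).
(* Covering [X] alone gains at least 1/2 per vertex, hence at least [ze / 2]; an exchange gains
   [ze / 2] per vertex by [swap_gain]. *)
have [Y [sY hY gain]] : exists Y : {set V}, [/\ Y \subset K j,
   (Y = set0 /\ #|K j|%:R <= (al - th) * sz%:R) \/
   (#|Y| = #|X| /\ #|X|%:R + 1 <= dl * #|K j|%:R) &
   \sum_(y in Y) cost W y - \sum_(x in X) cost W x <= - (ze / 2 * l%:R)].
  case/orP: hj => hj.
    exists set0; split; [exact: sub0set|by left|].
    rewrite big_set0 sub0r lerN2 -cX -sum1_card natr_sum mulr_sumr.
    apply: ler_sum => x _; have /andP[h _] := cost_bounds W x; lra.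
  have [Y sY cY] := exists_subset_card hj.
  rewrite -/l in cY.
  exists Y; split; first exact: subset_trans sY (subsetIl _ _).
    right; split; first by rewrite cX.
    (* As [K j] has at least [s / 2 * sz] vertices, the choice of [ka] gives [dl * #|K j|] at least
       [2 * ka * sz], which leaves room for [#|X| + 1]. *)
    have nj : s / 2 * sz%:R <= #|K j|%:R.
      apply: (class_ge e_irr) vK _ => //.
      have : (r%:R - 1) * al <= (r%:R - 1) * (a + rho).
        by rewrite ler_wpM2l // subr_ge0; lra.
      have := rho_s; lra.
    have : dl * (s / 2 * sz%:R) <= dl * #|K j|%:R by rewrite ler_wpM2l // ltW.
    have : ka * sz%:R <= dl * (s / 4) * sz%:R by rewrite ler_wpM2r.
    rewrite cX; lra.
  rewrite -cX; apply: swap_gain => [|||x xX]; rewrite ?cX //.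
    apply: subset_trans sKW; apply: subset_trans (sub_supp _ j).
    exact: subset_trans sY (subsetIl _ _).
  apply/subsetP => y yY; have /setIP[yj yh] := subsetP sY _ yY.
  have : y \in high e W ze x1' :&: supp K by rewrite inE yh (mem_supp yj).
  by have [_ <-] := hX x xX; rewrite inE => /andP[].
have YK : Y \subset supp K by apply: subset_trans sY (sub_supp _ _).
have [K1 [K2 [[m1 m2] [v1 v2] [d12 s12] [lo1 hi1] [lo2 hi2]]]] :
  exists K1 K2 : tile,
    [/\ multipartite e K1 /\ multipartite e K2,
        (forall i, #|K1 i|%:R <= (al + xi) * #|supp K1|%:R) /\
        (forall i, #|K2 i|%:R <= (al + xi) * #|supp K2|%:R),
        [disjoint supp K1 & supp K2] /\
        supp K1 :|: supp K2 = (supp K :\: Y) :|: X,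
        dl * #|supp K|%:R - r%:R <= #|supp K1|%:R :> R /\ (#|supp K1| <= #|supp K|)%N &
        (1 - dl) * #|supp K|%:R <= #|supp K2|%:R :> R /\ (#|supp K2| <= #|supp K|)%N].
  apply: (@tile_step _ _ _ e e_sym e_irr al xi dl th ka K X Y P j) => //.
  - by rewrite d0.
  - by rewrite al1 andbT (le_trans _ al_lo) // addr_ge0 // ltW.
  - by rewrite x0.
  - by rewrite cX.
exists (K1 |: (K2 |: (T' :\ K))).
have s12W : supp K1 :|: supp K2 \subset W.
  rewrite s12 subUset (subset_trans (subsetDl _ _)) //.
  exact: subset_trans XW (subsetDl _ _).
have ok1 : is_tile e W (al + xi) t t0 K1.
  split => //; first exact: subset_trans (subsetUl _ _) s12W.
  rewrite (leq_trans hi1 Kt) andbT -(ler_nat R) (le_trans _ lo1) //.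
  by rewrite lerBrDr.
have ok2 : is_tile e W (al + xi) t t0 K2.
  split => //; first exact: subset_trans (subsetUr _ _) s12W.
  rewrite (leq_trans hi2 Kt) andbT -(ler_nat R) (le_trans _ lo2) //.
  apply: le_trans (_ : dl * sz%:R <= _).
    by apply: le_trans big4; rewrite lerDl.
  by rewrite ler_wpM2r //; lra.
have [hT2 cT2] := tiling_replace hT' KT' ok1 ok2 d12 s12 YK dX.
have massE : mass (K |: Q) = sz%:R + mass Q by rewrite big_setU1.
split=> //; split=> //.
- by rewrite subUset sub1set KT.
- apply/subsetP => K' /setDP[K'T]; rewrite !inE negb_or => /andP[-> nQ] /=.
  by rewrite (subsetP sT') ?inE ?nQ ?orbT.
- rewrite (Psi_update cT2) //; last first.
  + exact: subset_trans YK sKW.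
  + exact: subset_trans YK (sub_cov KT').
  rewrite massE.
  have zel : ze * ka / 4 * sz%:R <= ze / 2 * l%:R.
    have -> : ze * ka / 4 * sz%:R = ze / 4 * (ka * sz%:R) by ring.
    have -> : ze / 2 * l%:R = ze / 4 * (2 * l%:R) by field.
    by rewrite ler_wpM2l // divr_ge0 // ltW.
  have -> : Psi W T' - \sum_(x in X) cost W x + \sum_(y in Y) cost W y =
      Psi W T' + (\sum_(y in Y) cost W y - \sum_(x in X) cost W x) by ring.
  have -> : Psi W T - ze * ka / 4 * (sz%:R + mass Q) =
      Psi W T - ze * ka / 4 * mass Q + - (ze * ka / 4 * sz%:R) by ring.
  by apply: lerD => //; apply: le_trans gain _; rewrite lerN2.
- rewrite massE.
  apply: le_trans (_ : (#|(W :\: cov T) :&: cov T'| + #|X|)%:R <= _).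
    rewrite ler_nat cT2 (leq_trans _ (leq_card_setU _ _)) // subset_leq_card //.
    apply/subsetP => x; rewrite !inE => /andP[-> /orP[/andP[_ ->]//|->]].
    by rewrite orbT.
  by rewrite natrD cX mulrDr addrC lerD.
Qed.

Lemma improvement_round : exists T', tiling e W (al + xi) t t0 T' /\
  Psi W T' <= Psi W T - ze * ka / 4 * (ga / 4) * #|W|%:R.
Proof.
have main m Q T' : (#|T :\: Q| <= m)%N -> state Q T' ->
    exists Q' T'', state Q' T'' /\ ga / 4 * #|W|%:R <= mass Q'.
  elim: m Q T' => [|m IH] Q T' hm hS.
    exists Q, T'; split=> //; rewrite leNgt; apply/negP => /(state_step hS).
    move=> [K [_ [KT _]]]; move: hm; rewrite leqn0 cards_eq0 => /eqP E.
    by rewrite E inE in KT.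
  have [h|h] := leP (ga / 4 * #|W|%:R) (mass Q); first by exists Q, T'.
  have [K [T'' [KT hS']]] := state_step hS h.
  apply: (IH _ T'' _ hS'); rewrite -ltnS (leq_trans _ hm) //.
  apply: proper_card; apply/properP; split; last by exists K; rewrite // !inE eqxx.
  by apply: setDS; apply: subsetUr.
have t1t : (t <= t1)%N.
  rewrite -(ler_nat R); move: (dl2) (t1d) => d2 td.
  have : dl * t1%:R <= 2^-1 * t1%:R by rewrite ler_wpM2r.
  have : 0 <= t1%:R :> R by []. have : 0 <= r%:R :> R by []. lra.
have [|Q [T' [[_ _ hT' hPsi _] hm]]] := main _ set0 T (leqnn _).
  split; rewrite ?big_set0 ?mulr0 ?subr0 ?setD0 ?sub0set //.
    by apply: tilingW hT => //; rewrite lerDl ltW.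
  by rewrite (_ : _ :&: _ = set0) ?cards0 //; apply/setP => x;
    rewrite !inE; case: (x \in cov T); rewrite ?andbF.
exists T'; split=> //; apply: le_trans hPsi _.
rewrite lerD2l lerN2 -mulrA ler_wpM2l // divr_ge0 // mulr_ge0 // ltW //.
Qed.
End Process.
End Round.

(** * Iterating rounds and deleting vertices *)

Lemma exists_nat_gt (R : realType) (x : R) : exists n : nat, x < n%:R.
Proof. by exists (Num.truncn x).+1; apply: truncnS_gt. Qed.

Section Polish.
Variables (R : realType) (r : nat) (a s : R).
Hypotheses (r_gt1 : (1 < r)%N) (s_gt0 : 0 < s) (le_s_a : s <= a)
  (asE : (r%:R - 1) * a + s = 1).

(** The order of the quantifiers matters: the gain [beta] is independent of [al], [xi] and [t], so
    the number of rounds is known before the balance and the sizes of the tiles are fixed. *)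
Lemma round_improve (ga eta rho0 rho1 : R) :
  0 < ga -> ga <= 1 -> 0 < eta -> 0 < rho0 ->
  (r%:R - 1) * rho1 <= s / 2 -> (r%:R - 2) * rho1 <= ga / 16 ->
  exists2 beta : R, 0 < beta & forall (al xi : R) (t : nat),
    a + rho0 <= al -> al <= a + rho1 -> al <= 1 -> 0 < xi -> xi <= 1 ->
    exists t1 : nat, forall t0 : nat, exists n0 : nat,
    forall (V : finType) (e : rel V) (W : {set V})
      (T : {set {ffun 'I_r -> {set V}}}),
      symmetric e -> irreflexive e ->
      tiling e W al t1 t0 T -> degree_cond r e a s W ga -> (n0 <= #|W|)%N ->
      eta * #|W|%:R <= #|W :\: cov T|%:R ->
      #|W :\: cov T|%:R <= ga / 4 * #|W|%:R ->
      exists T' : {set {ffun 'I_r -> {set V}}}, tiling e W (al + xi) t t0 T' /\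
        Psi R e W T' <= Psi R e W T - beta * #|W|%:R.
Proof.
move=> ga0 ga1 eta0 rho00 rs rga.
(* This value is also used for [ze], and [rho0] for [th]. Each of the four terms in the error bound
   is then at most [ga / 16]. *)
pose dl := ga / 16.
have dl0 : 0 < dl by rewrite /dl; lra.
pose ka := Num.min (Num.min (dl * rho0) (dl * (s / 4))) (eta / 2).
have ka0 : 0 < ka by rewrite !lt_min !mulr_gt0 //; lra.
have k1 : ka <= dl * rho0 by rewrite !ge_min lexx.
have k2 : ka <= dl * (s / 4) by rewrite !ge_min lexx orbT.
have k3 : ka <= eta / 2 by rewrite !ge_min lexx !orbT.
exists (dl * ka / 4 * (ga / 4)); first by rewrite !mulr_gt0 //; lra.
move=> al xi t al_lo al_hi al1 xi0 xi1.
pose M := 2 * r%:R / (xi * dl) + 2 / xi + 2 / ka + (t%:R + r%:R) / dl.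
have [t1 Mt1] := exists_nat_gt M.
have p1 : 0 <= 2 * r%:R / (xi * dl) by apply: divr_ge0; apply: mulr_ge0 => //; apply: ltW.
have p2 : 0 <= 2 / xi by rewrite divr_ge0 // ltW.
have p3 : 0 <= 2 / ka by rewrite divr_ge0 // ltW.
have p4 : 0 <= (t%:R + r%:R) / dl by rewrite divr_ge0 ?addr_ge0 // ltW.
have q1 : 2 * r%:R / (xi * dl) <= t1%:R by rewrite /M in Mt1; lra.
have q2 : 2 / xi <= t1%:R by rewrite /M in Mt1; lra.
have q3 : 2 / ka <= t1%:R by rewrite /M in Mt1; lra.
have q4 : (t%:R + r%:R) / dl <= t1%:R by rewrite /M in Mt1; lra.
have {}q1 : 2 * r%:R <= xi * dl * t1%:R by rewrite [X in _ <= X]mulrC -ler_pdivrMr // mulr_gt0.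
have {}q2 : 2 <= xi * t1%:R by rewrite [X in _ <= X]mulrC -ler_pdivrMr.
have {}q3 : 2 <= ka * t1%:R by rewrite [X in _ <= X]mulrC -ler_pdivrMr.
have {}q4 : t%:R + r%:R <= dl * t1%:R by rewrite [X in _ <= X]mulrC -ler_pdivrMr.
exists t1 => t0.
have [n0 hn0] := exists_nat_gt (8 * (4 ^ t0 * t0)%:R / (eta * ga)).
exists n0 => V e W T e_sym e_irr hT hD nW U1 U2.
have nWR : n0%:R <= #|W|%:R :> R by rewrite ler_nat.
have a0 : 0 < a by apply: lt_le_trans le_s_a.
have s1 : s <= 1.
  have : 0 <= (r%:R - 1) * a by rewrite mulr_ge0 ?ltW // subr_gt0 ltr1n.
  by move: asE; lra.
have kadl : ka <= dl.
  have : dl * (s / 4) <= dl * 1 by rewrite ler_wpM2l ?ltW //; lra.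
  lra.
apply: (@improvement_round R r V e r_gt1 e_sym e_irr a s s_gt0 le_s_a asE W al xi rho0 dl dl
   ka rho1 ga eta t t1 t0 T) => //.
- by rewrite /dl; lra.
- by rewrite /dl; lra.
- rewrite /dl in kadl *; lra.
- move: hn0; rewrite ltr_pdivrMr ?mulr_gt0 // => h; apply: lt_le_trans h _.
  by rewrite mulrC ler_wpM2l // mulr_ge0 // ltW.
Qed.

Section Family.
Variables (I : Type) (P : I -> Prop) (V : I -> finType) (e : forall i, rel (V i)).
Arguments e : clear implicits.
Hypotheses (e_sym : forall i, symmetric (e i)) (e_irr : forall i, irreflexive (e i)).

(* Moves shorten the tiles and worsen their balance, hence the quantification
   over [t]; [al] is increased from one statement to the next. *)
Definition good (W : forall i, {set V i}) (al x : R) :=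
  forall t : nat, exists t0 n0 : nat, forall i, P i -> (n0 <= #|W i|)%N ->
    exists T : {set {ffun 'I_r -> {set V i}}},
      tiling (e i) (W i) al t t0 T /\ Psi R (e i) (W i) T <= x * #|W i|%:R.

Lemma good_mono (W : forall i, {set V i}) (al al' x x' : R) :
  al <= al' -> x <= x' -> good W al x -> good W al' x'.
Proof.
move=> lal lx hg t; have [t0 [n0 h]] := hg t; exists t0, n0 => i Pi Wi.
have [T [hT hP]] := h i Pi Wi; exists T; split; first exact: tilingW hT.
by apply: le_trans hP _; rewrite ler_wpM2r.
Qed.

(** Iterate [round_improve]: as long as at least the proportion [eta] is uncovered, a round lowers
    [Psi] by [beta * #|W i|], so about [(x - eta) / beta] rounds suffice. *)
Lemma good_polish (W : forall i, {set V i}) (al al' x ga eta : R) :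
  0 < ga -> ga <= 1 -> 0 < eta -> eta <= ga / 8 -> a < al -> al < al' ->
  (r%:R - 1) * (al' - a) <= s / 2 -> (r%:R - 2) * (al' - a) <= ga / 16 -> al' <= 1 ->
  (exists n0 : nat, forall i, P i -> (n0 <= #|W i|)%N -> degree_cond r (e i) a s (W i) ga) ->
  x <= ga / 8 -> good W al x -> good W al' eta.
Proof.
move=> ga0 ga1 eta0 eta_ga a_al al_al' rs rga al'1 [nD hD] x_ga hg.
have [|||beta beta0 hbeta] := @round_improve ga eta (al - a) (al' - a) ga0 ga1 eta0 _ _ _ => //.
  by rewrite subr_gt0.
have [m hm] := exists_nat_gt ((x - eta) / beta).
rewrite ltr_pdivrMr // in hm.
have {hm} hm : x <= eta + m%:R * beta by lra.
suff main k al1 y : y <= ga / 8 -> al1 < al' -> y <= eta + k%:R * beta ->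
    good W al1 y -> al <= al1 -> good W al' eta by exact: main hm hg _.
elim: k al1 y {x x_ga hm hg} => [|k IH] al1 x x_ga al1_al' hm hg al_al1.
  rewrite mulr0n mul0r addr0 in hm.
  by apply: good_mono hg; lra.
(* Using half of the remaining gap keeps the balance strictly below [al'] after any number of
   rounds. *)
pose xi := (al' - al1) / 2.
pose x1 := Num.max eta (x - beta).
have a0 : 0 < a by apply: lt_le_trans le_s_a.
apply: (IH (al1 + xi) x1).
- by rewrite /x1 ge_max eta_ga /=; lra.
- by rewrite /xi; lra.
- have : 0 <= k%:R * beta by rewrite mulr_ge0 // ltW.
  rewrite -natr1 in hm; rewrite /x1 ge_max => h; apply/andP; split; lra.
- move=> t.
  have [|||||t1 ht1] := hbeta al1 xi t; rewrite /xi; try lra.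
  (* The tiles must have size [t1] if a round is made, and size [t] if none is needed. *)
  have [t0 [n0 ht0]] := hg (maxn t t1).
  have [n1 hn1] := ht1 t0.
  exists t0, (maxn n0 (maxn n1 nD)) => i Pi; rewrite !geq_max => /and3P[Wn0 Wn1 WnD].
  have [T [hT hPsi]] := ht0 i Pi Wn0.
  have N0 : 0 <= #|W i|%:R :> R by [].
  have x1e : eta * #|W i|%:R <= x1 * #|W i|%:R.
    by rewrite ler_wpM2r // /x1 le_max lexx.
  have x1b : (x - beta) * #|W i|%:R <= x1 * #|W i|%:R.
    by rewrite ler_wpM2r // /x1 le_max lexx orbT.
  have [hU|hU] := leP (eta * #|W i|%:R) #|W i :\: cov T|%:R; last first.
    exists T; split; last by apply: le_trans (Psi_le _ _ _ _) _; apply: le_trans (ltW hU) _.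
    by apply: tilingW hT; rewrite ?leq_maxl //; lra.
  have hT1 : tiling (e i) (W i) al1 t1 t0 T by apply: tilingW hT; rewrite ?leq_maxr.
  have hU2 : #|W i :\: cov T|%:R <= ga / 4 * #|W i|%:R.
    have := Psi_ge R (e i) (W i) T.
    have : x * #|W i|%:R <= ga / 8 * #|W i|%:R by rewrite ler_wpM2r.
    lra.
  have [T' [hT' hPsi']] := hn1 _ _ _ _ (@e_sym i) (@e_irr i) hT1 (hD _ Pi WnD) Wn1 hU hU2.
  by exists T'; split=> //; lra.
- by rewrite /xi; lra.
Qed.
End Family.

(** Shrink all classes by the same factor [1 - la], which preserves the balance. Every class has at
    least [s / 2 * sz] vertices, so with [la = 2 / s * f / sz] it loses at least [f] of them, enough
    to avoid [D]. The rounding loss [r] is at most [r * f]. *)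
Lemma tile_delete (V : finType) (e : rel V) (e_irr : irreflexive e) (W D : {set V})
    (al xi : R) (t t1 t0 : nat) (K : {ffun 'I_r -> {set V}}) :
  is_tile e W al t1 t0 K -> 0 < al -> al + xi <= 2 -> 0 < xi ->
  (r%:R - 1) * al <= 1 - s / 2 ->
  2 * (t%:R + r%:R) <= t1%:R :> R -> 4 * r%:R <= xi * t1%:R -> (0 < t1)%N ->
  exists S : {set {ffun 'I_r -> {set V}}},
    [/\ tiling e (W :\: D) (al + xi) t t0 S, cov S \subset supp K &
        #|supp K|%:R <= #|cov S|%:R + (4 / s + r%:R) * #|supp K :&: D|%:R].
Proof.
move=> hK al0 al1 xi0 hal t1a t1b t10.
have [sK mK vK /andP[tK Kt]] := hK.
set sz := #|supp K| in vK tK Kt *.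
set f : R := #|supp K :&: D|%:R.
have f0 : 0 <= f by [].
have r2 : 2 <= r%:R :> R by rewrite ler_nat.
have t0R : 0 <= t%:R :> R by [].
have s4 : 0 < 4 / s by rewrite divr_gt0.
have tsz : t1%:R <= sz%:R :> R by rewrite ler_nat.
have szgt0 : 0 < sz%:R :> R by rewrite ltr0n (leq_trans t10).
(* A tile that does not meet [D] is kept whole, since rounding could not be charged to [f]. *)
have [f_eq0|f_neq0] := eqVneq (#|supp K :&: D|) 0%N.
  exists [set K]; rewrite /cov big_set1; split=> //; last by rewrite /f f_eq0 mulr0 addr0.
  split=> [K' /set1P ->|K' K'' /set1P -> /set1P ->]; last by rewrite eqxx.
  split=> //.
  - rewrite subsetD sK /= -setI_eq0 -cards_eq0; exact/eqP.
  - by move=> i; apply: le_trans (vK i) _; rewrite ler_wpM2r //; lra.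
  - rewrite Kt andbT (leq_trans _ tK) // -(ler_nat R); lra.
have f1 : 1 <= f by rewrite /f ler1n lt0n.
pose la := 2 / s * f / sz%:R.
have laE : la * sz%:R = 2 / s * f by rewrite /la divfK // gt_eqF.
(* If more than half would go, the whole tile is dropped; it has fewer than [4 / s * f] vertices. *)
have [la2|la2] := ltP 2^-1 la.
  exists set0; rewrite /cov big_set0 cards0 sub0set; split=> //.
    by split=> [K'|K' K'']; rewrite inE.
  have : 2^-1 * sz%:R <= la * sz%:R by rewrite ler_wpM2r // ltW.
  have : 0 <= r%:R * f by rewrite mulr_ge0.
  have : 4 / s = 2 * (2 / s) by rewrite mulrA; congr (_ / _); lra.
  move=> ->; lra.
have la0 : 0 <= la by rewrite /la !mulr_ge0 ?invr_ge0 // ltW.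
have nge i : s / 2 * sz%:R <= #|K i|%:R by apply: (class_ge e_irr) vK hal.
pose d i := Num.truncn ((1 - la) * #|K i|%:R).
have la1 : 0 <= 1 - la by lra.
have dle i : (d i)%:R <= (1 - la) * #|K i|%:R :> R by rewrite truncn_le mulr_ge0.
have dgt i : (1 - la) * #|K i|%:R < (d i)%:R + 1 :> R by rewrite natr1 truncnS_gt.
have : forall i, exists C : {set V}, C \subset K i :\: D /\ #|C| = d i.
  move=> i; have [|C sC cC] := @exists_subset_card _ (K i :\: D) (d i); last by exists C.
  rewrite -(ler_nat R) (le_trans (dle i)) //.
  have : #|K i|%:R = #|K i :&: D|%:R + #|K i :\: D|%:R :> R by rewrite -natrD cardsID.
  have : #|K i :&: D|%:R <= f by rewrite ler_nat subset_leq_card ?setSI ?sub_supp.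
  have : la * (s / 2 * sz%:R) <= la * #|K i|%:R by rewrite ler_wpM2l.
  have : la * (s / 2 * sz%:R) = f.
    by rewrite mulrCA laE; field; rewrite gt_eqF.
  lra.
move/(@fin_all_exists _ _) => [C hC].
have CK i : C i \subset K i by have [sC _] := hC i; apply: subset_trans sC (subsetDl _ _).
pose K1 : {ffun 'I_r -> {set V}} := [ffun i => C i].
have K1K i : K1 i \subset K i by rewrite ffunE.
have m1 : multipartite e K1 by apply: multipartite_sub mK.
have c1 i : #|K1 i| = d i by rewrite ffunE; case: (hC i).
have lo : (1 - la) * sz%:R - r%:R <= #|supp K1|%:R :> R.
  have -> : sz%:R = \sum_i #|K i|%:R :> R by rewrite /sz (card_supp e_irr mK) natr_sum.
  rewrite (card_supp e_irr m1) natr_sum mulr_sumr -[X in X%:R]card_ord -sumr_const -sumrB.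
  by apply: ler_sum => i _; rewrite c1; have := dgt i; lra.
have lasz : la * sz%:R <= 2^-1 * sz%:R by rewrite ler_wpM2r // ltW.
exists [set K1]; rewrite /cov big_set1; split; last 2 first.
- exact: supp_sub.
- have : r%:R <= r%:R * f by rewrite ler_peMr.
  have : 4 / s * f = 2 * (2 / s * f) by rewrite !mulrA; congr (_ / _ * _); lra.
  have : 0 <= 2 / s * f by rewrite mulr_ge0 // divr_ge0 // ltW.
  lra.
split=> [K' /set1P ->|K' K'' /set1P -> /set1P ->]; last by rewrite eqxx.
split=> //.
- apply/bigcupsP => i _; rewrite ffunE; have [sC _] := hC i.
  by apply: subset_trans sC _; apply: setSD; apply: subset_trans sK; apply: sub_supp.
- move=> i; rewrite c1; apply: le_trans (dle i) _.
  have : (1 - la) * #|K i|%:R <= (1 - la) * (al * sz%:R) by rewrite ler_wpM2l.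
  have : (al + xi) * ((1 - la) * sz%:R - r%:R) <= (al + xi) * #|supp K1|%:R.
    by rewrite ler_wpM2l //; lra.
  have : (al + xi) * r%:R <= 2 * r%:R by rewrite ler_wpM2r.
  have : xi * (2^-1 * sz%:R) <= xi * ((1 - la) * sz%:R) by rewrite ler_wpM2l ?(ltW xi0) //; lra.
  have : xi * t1%:R <= xi * sz%:R by rewrite ler_wpM2l // ltW.
  lra.
- rewrite -(ler_nat R) (leq_trans (subset_leq_card (supp_sub K1K)) Kt) andbT; lra.
Qed.

Lemma tiling_refine (V : finType) (e : rel V) (W W' : {set V})
    (al al' : R) (t t1 t0 : nat) (T : {set {ffun 'I_r -> {set V}}})
    (S : {ffun 'I_r -> {set V}} -> {set {ffun 'I_r -> {set V}}}) :
  tiling e W al t1 t0 T ->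
  (forall K, K \in T -> tiling e W' al' t t0 (S K) /\ cov (S K) \subset supp K) ->
  tiling e W' al' t t0 (\bigcup_(K in T) S K) /\
  #|cov (\bigcup_(K in T) S K)| = (\sum_(K in T) #|cov (S K)|)%N.
Proof.
move=> [hT dT] hS; split.
  split=> [K /bigcupP[L LT KL]|K K' /bigcupP[L LT KL] /bigcupP[L' LT' KL'] nKK'].
    by have [[h _] _] := hS _ LT; apply: h.
  have [ELL|nLL] := eqVneq L L'.
    by have [[_ h] _] := hS _ LT; apply: h => //; rewrite ELL.
  apply: disjointW (dT _ _ LT LT' nLL).
    by have [_ h] := hS _ LT; apply: subset_trans h; apply: sub_cov.
  by have [_ h] := hS _ LT'; apply: subset_trans h; apply: sub_cov.
have -> : cov (\bigcup_(K in T) S K) = \bigcup_(K in T) cov (S K).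
  apply/setP => x; apply/bigcupP/bigcupP => [[K /bigcupP[L LT KL] xK]|[L LT /bigcupP[K KL xK]]].
    by exists L => //; apply/bigcupP; exists K.
  by exists K => //; apply/bigcupP; exists L.
rewrite -[\bigcup_(K in T) _]setTI card_setI_bigcup => [|L L' LT LT' nLL].
  by apply: eq_bigr => K _; rewrite setTI.
apply: disjointW (dT _ _ LT LT' nLL); first by have [] := hS _ LT.
by have [] := hS _ LT'.
Qed.

(** The loss is linear in the number of deleted vertices, with a constant that does not depend on
    the sizes of the tiles. *)
Lemma tiling_delete (al xi : R) (t : nat) :
  0 < al -> al + xi <= 2 -> 0 < xi -> (r%:R - 1) * al <= 1 - s / 2 ->
  exists t1 : nat, forall (t0 : nat) (V : finType) (e : rel V) (W W' : {set V})
      (T : {set {ffun 'I_r -> {set V}}}),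
    irreflexive e -> W' \subset W -> tiling e W al t1 t0 T ->
    exists T' : {set {ffun 'I_r -> {set V}}}, tiling e W' (al + xi) t t0 T' /\
      #|W' :\: cov T'|%:R <= #|W :\: cov T|%:R + (4 / s + r%:R) * #|W :\: W'|%:R.
Proof.
move=> al0 al1 xi0 hal.
have [t1 ht1] := exists_nat_gt (2 * (t%:R + r%:R) + 4 * r%:R / xi).
have r0 : 0 <= r%:R :> R by [].
have t0R : 0 <= t%:R :> R by [].
have p1 : 0 <= 4 * r%:R / xi by rewrite divr_ge0 ?mulr_ge0 // ltW.
have t1gt0 : (0 < t1)%N by rewrite -(ltr_nat R); lra.
have q1 : 2 * (t%:R + r%:R) <= t1%:R :> R by lra.
have q2 : 4 * r%:R / xi <= t1%:R :> R by lra.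
have {}q2 : 4 * r%:R <= xi * t1%:R by rewrite [X in _ <= X]mulrC -ler_pdivrMr.
exists t1 => t0 V e W W' T e_irr sW hT; have [hT1 _] := hT.
have W'E : W' = W :\: (W :\: W') by rewrite setDDr setDv set0U (setIidPr sW).
have : forall K : {ffun 'I_r -> {set V}}, exists S : {set {ffun 'I_r -> {set V}}}, K \in T ->
    [/\ tiling e W' (al + xi) t t0 S, cov S \subset supp K &
        #|supp K|%:R <= #|cov S|%:R + (4 / s + r%:R) * #|supp K :&: (W :\: W')|%:R].
  move=> K; have [KT|KT] := boolP (K \in T); last by exists set0.
  have [S hS] := tile_delete e_irr (W :\: W') (hT1 _ KT) al0 al1 xi0 hal q1 q2 t1gt0.
  by exists S => _; rewrite {1}W'E.
move/(@fin_all_exists _ _) => [S hS].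
have [|hT' cT'] := @tiling_refine _ _ _ W' _ (al + xi) t _ _ _ S hT.
  by move=> K /hS[].
exists (\bigcup_(K in T) S K); split=> //.
set T' := \bigcup_(K in T) S K in hT' cT' *.
have E1 : #|W|%:R = #|cov T|%:R + #|W :\: cov T|%:R :> R.
  by rewrite -natrD -(cardsID (cov T) W) (setIidPr (cov_sub hT)).
have E2 : #|W'|%:R = #|cov T'|%:R + #|W' :\: cov T'|%:R :> R.
  by rewrite -natrD -(cardsID (cov T') W') (setIidPr (cov_sub hT')).
have E3 : #|W'|%:R <= #|W|%:R :> R by rewrite ler_nat subset_leq_card.
have E4 : #|cov T|%:R <= #|cov T'|%:R + (4 / s + r%:R) * #|(W :\: W') :&: cov T|%:R.
  rewrite (card_cov hT) cT' (card_setI_cov _ hT) !natr_sum mulr_sumr -big_split /=.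
  by apply: ler_sum => K /hS[_ _]; rewrite setIC.
have E5 : (4 / s + r%:R) * #|(W :\: W') :&: cov T|%:R <= (4 / s + r%:R) * #|W :\: W'|%:R.
  rewrite ler_wpM2l ?addr_ge0 ?divr_ge0 ?(ltW s_gt0) //.
  by rewrite ler_nat subset_leq_card ?subsetIl.
lra.
Qed.
End Polish.

(** * Universal vertices *)

Lemma card_rank_itv (T : finType) (lo hi : nat) : (lo <= hi <= #|T|)%N ->
  #|[set x : T | lo <= enum_rank x < hi]%N| = (hi - lo)%N.
Proof.
move=> /andP[lohi hiT]; rewrite -sum1dep_card.
rewrite (reindex_onto (@enum_val _ (pred_of_simpl T)) enum_rank) => [|x _]; last exact: enum_rankK.
rewrite (eq_bigl (fun i : 'I_#|T| => lo <= i < hi)%N) => [|i]; last by rewrite enum_valK eqxx andbT.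
rewrite -(big_mkord (fun i => lo <= i < hi)%N (fun=> 1%N)).
rewrite (@big_cat_nat _ _ _ hi) //= (@big_cat_nat _ _ _ lo) //=.
rewrite [X in (X + _ + _)%N]big_nat_cond [X in (X + _ + _)%N]big_pred0 => [|i]; last by lia.
rewrite [X in (_ + _ + X)%N]big_nat_cond [X in (_ + _ + X)%N]big_pred0 => [|i]; last by lia.
rewrite add0n addn0; transitivity (\sum_(lo <= i < hi) 1)%N.
  by rewrite [LHS]big_nat_cond [RHS]big_nat_cond; apply: eq_bigl => i; lia.
by rewrite sum_nat_const_nat muln1.
Qed.

Definition low_degree (R : realType) (G : sgraph) (D : R) : {set G} :=
  [set y : G | (degree y)%:R <= D].

(** Translates the degree sequence into counting: if entry [z] exceeded [D], so would all later
    ones, and at most [z - 1] entries would be at most [D]. *)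
Lemma dseq_count_le (R : realType) (G : sgraph) (D : R) :
  (0 < #|low_degree G D|)%N -> (dseq G #|low_degree G D|)%:R <= D.
Proof.
set z := #|_| => z0; rewrite leNgt; apply/negP => hD.
pose p := [pred d : nat | d%:R <= D].
have hz : z = count p (degree_seq G).
  rewrite /degree_seq (permP (permEl (perm_sort _ _))) count_map.
  by rewrite /z cardE {1}/enum_mem size_filter enumT; apply: eq_count => x; rewrite /= inE.
have hs : sorted leq (degree_seq G) by apply: sort_sorted; apply: leq_total.
have zs : (z <= size (degree_seq G))%N by rewrite hz count_size.
clearbody z.
have : (z <= z.-1)%N.
  rewrite {1}hz -(cat_take_drop z.-1 (degree_seq G)) count_cat.
  rewrite [X in (_ + X)%N](_ : _ = 0%N) ?addn0.
    by rewrite (leq_trans (count_size _ _)) // size_take_min geq_minl.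
  apply/eqP; rewrite -leqn0 leqNgt -has_count; apply/hasPn => d.
  move=> /(nthP 0%N)[i]; rewrite size_drop nth_drop => hi <-; rewrite inE -ltNge.
  apply: lt_le_trans hD _; rewrite ler_nat /dseq.
  apply: (sorted_leq_nth leq_trans leqnn) => //; rewrite ?inE -?ltn_subRL ?leq_addr //.
  by rewrite prednK.
by lia.
Qed.

Lemma dseq_mono (G : sgraph) i j : (0 < i <= j)%N -> (j <= #|G|)%N ->
  (dseq G i <= dseq G j)%N.
Proof.
move=> /andP[i0 ij] jG.
have hs : sorted leq (degree_seq G) by apply: sort_sorted; apply: leq_total.
have sz : size (degree_seq G) = #|G| by rewrite size_sort size_map -cardE.
by apply: (sorted_leq_nth leq_trans leqnn) => //; rewrite ?inE ?sz; lia.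
Qed.

Section Universal.
Variables (R : realType) (r : nat) (a s : R).
Hypotheses (r_gt1 : (1 < r)%N) (s_gt0 : 0 < s) (le_s_a : s <= a)
  (asE : (r%:R - 1) * a + s = 1).

Definition uvertex (G : sgraph) : finType := (G * 'I_r)%type.

(* The pairs [(x, 0)] form a copy of [G], all other pairs are universal. *)
Definition uedge (G : sgraph) : rel (uvertex G) := fun v w =>
  if (v.2 == 0 :> nat)%N && (w.2 == 0 :> nat)%N then edge v.1 w.1 else v != w.

Definition ucut (ka : R) (G : sgraph) := Num.truncn (ka * #|G|%:R).

(** The graphs with different numbers of universal vertices are induced on nested subsets of one
    vertex set, because ranks below [ucut ka G] are kept in each of the [r - 1] further layers.
    Lowering [ka] thus deletes vertices. *)
Definition uset (ka : R) (G : sgraph) : {set uvertex G} :=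
  [set v : uvertex G | (v.2 == 0 :> nat)%N || (enum_rank v.1 < ucut ka G)%N].

(** The degree hypothesis of the theorem in the normalised parameters [a] and [s]. *)
Definition komlos_degrees (G : sgraph) :=
  forall i : nat, (1 <= i)%N -> i%:R <= a * #|G|%:R ->
    (1 - a - s) * #|G|%:R + s / a * i%:R <= (dseq G i)%:R.

Lemma uedge_sym G : symmetric (@uedge G).
Proof.
move=> v w; rewrite /uedge andbC; case: ifP => _; last by rewrite eq_sym.
exact: edge_sym.
Qed.

Lemma uedge_irr G : irreflexive (@uedge G).
Proof. by move=> v; rewrite /uedge edge_irr eqxx; case: ifP. Qed.

Let i0 : 'I_r := Ordinal (ltnW r_gt1).

Lemma card_uset (ka : R) G : 0 <= ka <= 1 ->
  #|uset ka G| = (#|G| + r.-1 * ucut ka G)%N.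
Proof.
move=> /andP[ka0 ka1].
have cG : (ucut ka G <= #|G|)%N.
  by rewrite -[X in (_ <= X)%N](@natrK R) le_truncn // ler_piMl.
have -> : uset ka G = setX [set: G] [set i0] :|:
   setX [set x : G | 0 <= enum_rank x < ucut ka G]%N [set~ i0].
  apply/setP => -[x i]; rewrite !inE /=.
  have -> : (i == 0 :> nat)%N = (i == i0) by [].
  by case: (i == i0); rewrite ?orbT //= andbT.
rewrite cardsU !cardsX cardsT cards1 muln1 card_rank_itv ?subn0 //.
rewrite (_ : _ :&: _ = set0) ?cards0 ?subn0.
  by rewrite cardsC1 card_ord mulnC.
by apply/setP => -[x i]; rewrite !inE /=; case: (i == i0); rewrite ?andbF.
Qed.

Lemma dg_uset (ka : R) (G : sgraph) (x : G) (i : 'I_r) : 0 <= ka <= 1 -> (i == 0 :> nat)%N ->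
  (degree x + r.-1 * ucut ka G <= dg (@uedge G) (uset ka G) (x, i))%N.
Proof.
move=> ka01 i_0.
have cG : (ucut ka G <= #|G|)%N.
  case/andP: ka01 => ka0 ka1.
  by rewrite -[X in (_ <= X)%N](@natrK R) le_truncn // ler_piMl.
pose A := setX [set y : G | edge x y] [set i0].
pose B := setX [set y : G | 0 <= enum_rank y < ucut ka G]%N [set~ i0].
have -> : (degree x + r.-1 * ucut ka G = #|A :|: B|)%N.
  rewrite cardsU !cardsX cards1 muln1 card_rank_itv ?subn0 //.
  rewrite (_ : _ :&: _ = set0) ?cards0 ?subn0.
    by rewrite cardsC1 card_ord mulnC.
  by apply/setP => -[y j]; rewrite !inE /=; case: (j == i0); rewrite ?andbF.
apply/subset_leq_card/subsetP => -[y j]; rewrite !inE /= /uedge /= i_0.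
have -> : (j == 0 :> nat)%N = (j == i0) by [].
case: (eqVneq j i0) => [_|jE] /=; first by rewrite !andbT andbF orbF.
rewrite andbF andbT /= => -> /=; rewrite xpair_eqE negb_and.
have -> : i = i0 by apply/val_inj/eqP.
by rewrite [i0 == j]eq_sym (negbTE jE) orbT.
Qed.

Lemma dg_universal (ka : R) G (v : uvertex G) : v.2 != 0%N :> nat -> v \in uset ka G ->
  (#|uset ka G| <= (dg (@uedge G) (uset ka G) v).+1)%N.
Proof.
move=> v2 vW; rewrite (cardsD1 v) vW add1n ltnS.
apply/subset_leq_card/subsetP => w /setD1P[nwv wW]; rewrite !inE in wW *.
by rewrite wW /= /uedge (negbTE v2) /= eq_sym.
Qed.

(** The universal vertices raise all degrees in the copy of [G] by [(r - 1) * k], whereas the two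
    required bounds rise only by [1 - a - s] and [1 - a] times this amount. The slack is therefore
    at least [a * (r - 1) * k], and it is uniform for all [ka'] above [ka]. *)
Lemma degree_cond_uset (ka : R) : 0 < ka -> ka <= 1 ->
  exists n0 : nat, forall (G : sgraph) (ka' : R), ka <= ka' <= 1 ->
    komlos_degrees G -> (n0 <= #|uset ka' G|)%N ->
    degree_cond r (@uedge G) a s (uset ka' G) (ka * a / 4).
Proof.
move=> ka0 ka1.
have a0 : 0 < a by apply: lt_le_trans le_s_a.
have r2 : 2 <= r%:R :> R by rewrite ler_nat.
have r1E : r.-1%:R = r%:R - 1 :> R by rewrite -subn1 natrB // ltnW.
have [n0 hn0] := exists_nat_gt (r%:R * (4 / (ka * a)) : R).
exists n0 => G ka' /andP[ka_ka' ka'1] hG hW D [v vW hv].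
have ka'01 : 0 <= ka' <= 1 by rewrite ka'1 andbT; lra.
have NE : #|uset ka' G|%:R = #|G|%:R + (r%:R - 1) * (ucut ka' G)%:R :> R.
  by rewrite card_uset // natrD natrM r1E.
set k : R := (ucut ka' G)%:R in NE.
set n : R := #|G|%:R in NE.
set N : R := #|uset ka' G|%:R in NE *.
set ga := ka * a / 4.
have n_ge0 : 0 <= n by [].
have k_ge0 : 0 <= k by [].
have kn : k <= n.
  apply: le_trans (_ : ka' * n <= _); last by rewrite ler_piMl.
  by rewrite truncn_le mulr_ge0 //; case/andP: ka'01.
have klo : ka * n - 1 <= k.
  have : ka' * n < k + 1 by rewrite natr1 truncnS_gt.
  have : ka * n <= ka' * n by rewrite ler_wpM2r.
  lra.
have Nrn : N <= r%:R * n.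
  rewrite NE; have : (r%:R - 1) * k <= (r%:R - 1) * n by rewrite ler_wpM2l // subr_ge0; lra.
  lra.
have nbig : 4 / (ka * a) < n.
  have : r%:R * (4 / (ka * a)) < r%:R * n.
    by apply: lt_le_trans hn0 _; apply: le_trans Nrn; rewrite ler_nat.
  by rewrite ltr_pM2l //; lra.
have kan : 4 < ka * a * n by rewrite -ltr_pdivrMl ?mulr_gt0 // mulrC.
have an4 : 4 < a * n.
  have : ka * (a * n) <= a * n by rewrite ler_piMl // mulr_ge0 // ltW.
  by move: kan; lra.
have ga_le : ga <= a / 4.
  have : ka * a <= a by rewrite ler_piMl // ltW.
  by rewrite /ga; lra.
have ga_ge0 : 0 < ga by rewrite /ga divr_gt0 // mulr_gt0.
have r2a : 0 <= (r%:R - 2) * a by rewrite mulr_ge0 ?subr_ge0 // ltW.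
have r1a : (r%:R - 1) * a <= 1 by move: asE s_gt0; lra.
have a1 : a <= 1 by move: asE s_gt0; lra.
have nN : n <= N by rewrite NE lerDl mulr_ge0 // subr_ge0; lra.
have gaN : ga * N <= (r%:R - 1) * (ka * a * n) / 2.
  have : ga * N <= ga * (r%:R * n) by rewrite ler_wpM2l // ltW.
  have : r%:R * (ka * a * n) <= (2 * (r%:R - 1)) * (ka * a * n).
    by rewrite ler_wpM2r; lra.
  by rewrite /ga; lra.
(* The extra 1 pays for rounding [a * n] down to an index of the degree sequence. *)
have gak : ga * N + 1 <= a * (r%:R - 1) * k.
  have : (r%:R - 1) * a * (ka * n - 1) <= (r%:R - 1) * a * k.
    by rewrite ler_wpM2l // mulr_ge0 ?ltW //; lra.
  have : (r%:R - 1) * 4 <= (r%:R - 1) * (ka * a * n) by rewrite ler_wpM2l ?ltW //; lra.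
  lra.
(* If [D] is at least [N - 1], the second alternative is clear. Otherwise universal vertices, having
   degree at least [N - 1], do not count as low. *)
have [DN|DN] := leP (N - 1) D.
  right; have : ga * N <= a / 4 * N by rewrite ler_wpM2r // (le_trans n_ge0).
  have : a * n <= a * N by rewrite ler_wpM2l // ltW.
  lra.
have zero w : w \in uset ka' G -> (dg (@uedge G) (uset ka' G) w)%:R <= D -> (w.2 == 0 :> nat)%N.
  move=> wW hw; apply/negP => /negP w2; have := dg_universal w2 wW.
  rewrite -(ler_nat R) -natr1 -/N; lra.
pose D' := D - (r%:R - 1) * k.
have low1 w : w \in uset ka' G -> (dg (@uedge G) (uset ka' G) w)%:R <= D -> (degree w.1)%:R <= D'.
  move=> wW hw; have w2 := zero _ wW hw; have := dg_uset w.1 ka'01 w2.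
  by rewrite -(ler_nat R) natrD natrM r1E -surjective_pairing /D' -/k; lra.
set z' := #|low_degree G D'|.
have z'0 : (0 < z')%N by apply/card_gt0P; exists v.1; rewrite inE low1.
have zz' : #|low (@uedge G) (uset ka' G) D|%:R <= z'%:R :> R.
  rewrite ler_nat -(card_in_imset (f := fst)) => [|w w'].
    apply/subset_leq_card/subsetP => x /imsetP[w]; rewrite in_set => /andP[wW hw] ->.
    by rewrite inE low1.
  rewrite in_set => /andP[wW hw]; rewrite in_set => /andP[wW' hw'] E.
  rewrite [w]surjective_pairing [w']surjective_pairing E; congr pair.
  by apply: val_inj; rewrite /= (eqP (zero _ wW hw)) (eqP (zero _ wW' hw')).
have dz := dseq_count_le z'0; rewrite -/z' in dz.
have asE' := asE; have sa0 : 0 <= s / a by rewrite divr_ge0 ?(ltW s_gt0) // ltW.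
have sa1 : s / a <= 1 by rewrite ler_pdivrMr // mul1r.
have s0 := s_gt0.
have [hz|hz] := leP z'%:R (a * n).
  left; have := hG _ z'0 hz; rewrite -/n => h.
  have h2 : s / a * #|low (@uedge G) (uset ka' G) D|%:R <= s / a * z'%:R by rewrite ler_wpM2l.
  have E : (1 - a - s) * n = (r%:R - 2) * a * n by congr (_ * _); lra.
  have E2 : (r%:R - 2) * a * N = (r%:R - 2) * a * n + (1 - a - s) * ((r%:R - 1) * k).
    by rewrite NE mulrDr; congr (_ + _ * _); lra.
  have : 0 <= s * ((r%:R - 1) * k) by rewrite !mulr_ge0 // ?subr_ge0 ?(ltW s_gt0) //; lra.
  rewrite /D' in dz; lra.
(* The hypothesis says nothing about index [z'] beyond [a * n], so it is used at the last admissible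
   index [i] and carried over by monotonicity. *)
right; pose i := Num.truncn (a * n).
have ile : i%:R <= a * n by rewrite truncn_le; lra.
have igt : a * n < i%:R + 1 by rewrite natr1 truncnS_gt.
have i1 : (0 < i)%N by rewrite -(ltr_nat R); lra.
have iz : (i <= z')%N by rewrite -(ler_nat R); lra.
have := hG _ i1 ile; rewrite -/n => h.
have : (dseq G i)%:R <= (dseq G z')%:R :> R.
  by rewrite ler_nat dseq_mono ?i1 //; apply: max_card.
have h2 : s / a * (a * n - 1) <= s / a * i%:R by rewrite ler_wpM2l //; lra.
have h3 : s / a * (a * n) = s * n by field; rewrite gt_eqF.
rewrite /D' in dz; rewrite NE; rewrite NE in gak; lra.
Qed.
End Universal.

(** * Removing the universal vertices step by step *)

Section Outer.
Variables (R : realType) (r : nat) (a s : R).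
Hypotheses (r_gt1 : (1 < r)%N) (s_gt0 : 0 < s) (le_s_a : s <= a)
  (asE : (r%:R - 1) * a + s = 1).

(** A block of [t] vertices of [G], repeated in all layers. Its copies in different layers are
    completely joined, because at most one of two layers is layer 0. *)
Definition initial_tile (G : sgraph) (t g : nat) : {ffun 'I_r -> {set uvertex r G}} :=
  [ffun i => setX [set x : G | g * t <= enum_rank x < g * t + t]%N [set i]].

Lemma mem_supp_initial_tile (G : sgraph) t g (v : uvertex r G) :
  (v \in supp (initial_tile G t g)) = (g * t <= enum_rank v.1 < g * t + t)%N.
Proof.
apply/bigcupP/idP => [[i _]|h]; first by rewrite ffunE !inE => /andP[].
by exists v.2; rewrite // ffunE !inE h eqxx.
Qed.

Lemma initial_tile_ok (G : sgraph) t g (al : R) : (g < #|G| %/ t)%N -> 1 <= r%:R * al ->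
  is_tile (@uedge r G) (uset r (1 : R) G) al t (r * t) (initial_tile G t g).
Proof.
move=> hg ral.
have hgt : (g * t + t <= #|G|)%N.
  by rewrite -mulSnr (leq_trans _ (leq_divM _ t)) // leq_mul2r hg orbT.
have mK : multipartite (@uedge r G) (initial_tile G t g).
  move=> i j [x i'] [y j'] nij; rewrite !ffunE !inE /= => /andP[_ /eqP ->] /andP[_ /eqP ->].
  rewrite /uedge /=; case: ifP => [/andP[/eqP i0 /eqP j0]|_].
    by case/eqP: nij; apply: val_inj; rewrite /= i0 j0.
  by rewrite xpair_eqE negb_and nij orbT.
have cK i : #|initial_tile G t g i| = t.
  by rewrite ffunE cardsX cards1 muln1 card_rank_itv ?leq_addr // addKn.
have szE : #|supp (initial_tile G t g)| = (r * t)%N.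
  rewrite (card_supp (@uedge_irr r G) mK) (eq_bigr (fun=> t)) => [|i _]; last exact: cK.
  by rewrite sum_nat_const card_ord.
split=> //.
- apply/subsetP => v _; rewrite inE /ucut mul1r natrK ltn_ord orbT //.
- move=> i; rewrite cK szE natrM mulrA ler_peMl //; lra.
- by rewrite szE leqnn andbT leq_pmull // ltnW.
Qed.

Notation ugood ka al x := (good r (komlos_degrees a s) (@uedge r) (uset r (ka : R)) al x).

Lemma good_start (al x : R) : 1 <= r%:R * al -> 0 < x -> ugood 1 al x.
Proof.
(* The successor keeps the block length positive. *)
move=> ral x0 t; pose t' := t.+1.
have [n0 hn0] := exists_nat_gt (r%:R * t'%:R / x).
exists (r * t')%N, n0 => G _ hN.
pose T := [set initial_tile G t' (g : 'I_(#|G| %/ t')) | g in 'I_(#|G| %/ t')].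
exists T; split; first split.
- move=> K /imsetP[g _ ->]; apply: is_tileW (initial_tile_ok _ ral) => //.
- move=> K K' /imsetP[g _ ->] /imsetP[g' _ ->] nK.
  rewrite -setI_eq0 -subset0; apply/subsetP => v /setIP[].
  rewrite !mem_supp_initial_tile => h h'; case/eqP: nK; congr (initial_tile G t' _).
  have : (g < g'.+1)%N && (g' < g.+1)%N.
    rewrite -(ltn_pmul2r (m := t')) // -[(g' < _)%N](ltn_pmul2r (m := t')) // !mulSnr.
    lia.
  by rewrite !ltnS -eqn_leq => /eqP.
apply: le_trans (Psi_le _ _ _ _) _.
suff: uset r (1 : R) G :\: cov T \subset
    setX [set y : G | #|G| %/ t' * t' <= enum_rank y < #|G|]%N [set: 'I_r].
  move/subset_leq_card; rewrite cardsX card_rank_itv ?leq_divM //= cardsT card_ord => h.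
  apply: le_trans (_ : (r * t')%:R <= _).
    rewrite ler_nat (leq_trans h) // mulnC leq_mul2l.
    by rewrite [X in (X - _)%N](divn_eq #|G| t') addKn ltnW ?orbT ?ltn_mod.
  have : n0%:R <= #|uset r (1 : R) G|%:R :> R by rewrite ler_nat.
  move=> h2; rewrite natrM [X in _ <= X]mulrC -ler_pdivrMr //.
  exact: le_trans (ltW hn0) h2.
apply/subsetP => v /setDP[_ nv]; rewrite !inE andbT ltn_ord andbT leqNgt.
apply: contra nv => hv.
have hg : (enum_rank v.1 %/ t' < #|G| %/ t')%N by rewrite ltn_divLR.
apply/bigcupP; exists (initial_tile G t' (Ordinal hg)); first by apply: imset_f.
rewrite mem_supp_initial_tile /= leq_divM /= -mulSnr -ltn_divLR //.
Qed.

Lemma card_usetB (ka ka' : R) (G : sgraph) : 0 <= ka' -> ka' <= ka -> ka <= 1 ->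
  uset r ka' G \subset uset r ka G /\
  #|uset r ka G :\: uset r ka' G|%:R <= r%:R * ((ka - ka') * #|G|%:R + 1) :> R.
Proof.
move=> ka'0 ka'ka ka1.
have ka0 : 0 <= ka by lra.
have cc : (ucut ka' G <= ucut ka G)%N by rewrite /ucut le_truncn // ler_wpM2r.
have sub : uset r ka' G \subset uset r ka G.
  by apply/subsetP => v; rewrite !inE => /orP[->//|h]; rewrite (leq_trans h cc) orbT.
split=> //.
rewrite cardsD (setIidPr sub) !(card_uset r_gt1) ?ka0 ?ka'0 //; last lra.
rewrite subnDl -mulnBr natrM natrB //.
have h1 : (ucut ka G)%:R <= ka * #|G|%:R by rewrite truncn_le mulr_ge0.
have h2 : ka' * #|G|%:R < (ucut ka' G)%:R + 1 by rewrite natr1 truncnS_gt.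
apply: ler_pM => //; last lra.
- by rewrite subr_ge0 ler_nat.
- by rewrite ler_nat leq_pred.
Qed.

(** In the first term, 2 comes from passing from [Psi] to the number of uncovered vertices and [r]
    from comparing the old vertex set with the new one. In the second, [r] bounds the number of
    layers and 2 absorbs the rounding of [ucut]. *)
Lemma good_shrink (ka ka' al al' x : R) : 0 <= ka' -> ka' < ka -> ka <= 1 ->
  0 < al -> al < al' -> al' <= 2 -> (r%:R - 1) * al <= 1 - s / 2 -> 0 <= x ->
  ugood ka al x ->
  ugood ka' al' (2 * r%:R * x + 2 * r%:R * (4 / s + r%:R) * (ka - ka')).
Proof.
move=> ka'0 kk ka1 al0 al_al' al'2 hal x0 hg t.
have h2 : al + (al' - al) <= 2 by lra.
have h3 : 0 < al' - al by lra.
have [t1 ht1] := tiling_delete r_gt1 s_gt0 t al0 h2 h3 hal.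
have [t0 [n0 hn0]] := hg t1.
have [n1 hn1] := exists_nat_gt (r%:R / (ka - ka')).
exists t0, (maxn n0 n1) => G PG; rewrite geq_max => /andP[N0 N1].
have [sub cB] := card_usetB G ka'0 (ltW kk) ka1.
have [T [hT hPsi]] := hn0 G PG (leq_trans N0 (subset_leq_card sub)).
have [T' [hT' hU']] := ht1 t0 _ _ _ _ _ (@uedge_irr r G) sub hT.
exists T'; rewrite subrKC in hT'; split=> //.
apply: le_trans (Psi_le _ _ _ _) _.
apply: le_trans hU' _.
have r2 : 2 <= r%:R :> R by rewrite ler_nat.
set N' : R := #|uset r ka' G|%:R; set n : R := #|G|%:R in cB.
have ka0 : 0 <= ka by lra.
have N'n : n <= N'.
  by rewrite ler_nat (card_uset r_gt1) ?leq_addr // ka'0; lra.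
have Nn : #|uset r ka G|%:R <= r%:R * n.
  rewrite -natrM ler_nat (card_uset r_gt1) ?ka0 //.
  rewrite -[X in (_ <= X * _)%N](prednK (ltnW r_gt1)) mulSn leq_add2l leq_mul2l.
  by rewrite -[X in (_ <= X)%N](@natrK R) le_truncn ?orbT // ler_piMl.
have N'rn : N' <= r%:R * n.
  by apply: le_trans Nn; rewrite ler_nat subset_leq_card.
have n_ge0 : 0 <= n by [].
have nbig : 1 <= (ka - ka') * n.
  have : r%:R / (ka - ka') < r%:R * n.
    by apply: lt_le_trans hn1 _; apply: le_trans N'rn; rewrite ler_nat.
  rewrite ltr_pM2l; last lra.
  move=> h; have : (ka - ka') * (ka - ka')^-1 < (ka - ka') * n by rewrite ltr_pM2l ?subr_gt0.
  by rewrite mulfV ?gt_eqF ?subr_gt0 // => /ltW.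
have e1 : #|uset r ka G :\: cov T|%:R <= 2 * r%:R * x * N'.
  apply: le_trans (Psi_ge _ _ _ _) _.
  have : x * #|uset r ka G|%:R <= x * (r%:R * N').
    rewrite ler_wpM2l // (le_trans Nn) // ler_wpM2l //.
  lra.
have C0 : 0 <= 4 / s + r%:R by rewrite addr_ge0 // divr_ge0 // ltW.
have e2 : (4 / s + r%:R) * #|uset r ka G :\: uset r ka' G|%:R <=
    (4 / s + r%:R) * (r%:R * (2 * ((ka - ka') * N'))).
  rewrite ler_wpM2l // (le_trans cB) // ler_wpM2l //.
  have : (ka - ka') * n <= (ka - ka') * N' by rewrite ler_wpM2l // subr_ge0 ltW.
  lra.
rewrite [X in _ <= X]mulrDl lerD //; apply: le_trans e2 _.
by rewrite le_eqVlt; apply/orP; left; apply/eqP; ring.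
Qed.

(** Descend from 1 to [ka] in [L] steps. Each deletion raises the uncovered proportion from [e0] to
    at most [ga / 16], still small compared with the slack [ga], which is valid throughout;
    polishing then restores [e0]. *)
Lemma good_all (ka eta : R) : 0 < ka -> ka < 1 -> 0 < eta ->
  exists2 amax : R, a < amax & forall al, a < al -> al <= amax -> ugood ka al eta.
Proof.
move=> ka0 ka1 eta0.
have a0 : 0 < a by apply: lt_le_trans le_s_a.
have r2 : 2 <= r%:R :> R by rewrite ler_nat.
have s0 := s_gt0; have sa := le_s_a; have asE' := asE.
have r2a : 0 <= (r%:R - 2) * a by rewrite mulr_ge0 ?subr_ge0 // ltW.
have as1 : a + s <= 1 by lra.
pose ga := ka * a / 4.
have ga0 : 0 < ga by rewrite /ga divr_gt0 // mulr_gt0.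
have ga1 : ga <= 1.
  have : ka * a <= a by rewrite ler_piMl // ltW.
  by rewrite /ga; lra.
have r1a : 1 <= r%:R * a by lra.
pose de := Num.min (s / (2 * r%:R)) (ga / (16 * r%:R)).
have r0 : 0 < r%:R :> R by lra.
have de0 : 0 < de by rewrite lt_min !divr_gt0 ?mulr_gt0.
have de1 : de * r%:R <= s / 2.
  have : de <= s / (2 * r%:R) by rewrite ge_min lexx.
  by rewrite ler_pdivlMr ?mulr_gt0 //; lra.
have de2 : de * r%:R <= ga / 16.
  have : de <= ga / (16 * r%:R) by rewrite ge_min lexx orbT.
  by rewrite ler_pdivlMr ?mulr_gt0 //; lra.
have de3 : 2 * de <= de * r%:R by rewrite mulrC ler_wpM2l // ltW.
(* Chosen such that [2 * r * e0 = ga / 32]; the step length [ep] below adds at most another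
   [ga / 32]. *)
pose e0 := ga / (64 * r%:R).
have e00 : 0 < e0 by rewrite divr_gt0 // mulr_gt0.
have e0r : e0 * r%:R = ga / 64 by rewrite /e0; field; rewrite gt_eqF.
have e0s : 2 * e0 <= e0 * r%:R by rewrite mulrC ler_wpM2l // ltW.
have [n0 hdeg] := degree_cond_uset r_gt1 s_gt0 le_s_a asE ka0 (ltW ka1).
have polish ka' al al' x y : ka <= ka' <= 1 -> a < al -> al < al' -> al' <= a + de ->
    0 < y -> y <= ga / 8 -> x <= ga / 8 -> ugood ka' al x -> ugood ka' al' y.
  move=> hka' h1 h2 h3 y0 yga xga.
  apply: (@good_polish R r a s r_gt1 s_gt0 le_s_a asE sgraph (komlos_degrees a s) (uvertex r)
    (@uedge r) (@uedge_sym r) (@uedge_irr r) (uset r ka') al al' x ga y) => //.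
  - have : (r%:R - 1) * (al' - a) <= (r%:R - 1) * de by rewrite ler_wpM2l ?subr_ge0; lra.
    lra.
  - have : (r%:R - 2) * (al' - a) <= (r%:R - 2) * de by rewrite ler_wpM2l ?subr_ge0; lra.
    lra.
  - lra.
  - by exists n0 => G PG hN; apply: hdeg.
pose C := 2 * r%:R * (4 / s + r%:R).
have C0 : 0 < C.
  have : 0 < 4 / s by rewrite divr_gt0.
  by move=> h; rewrite /C !mulr_gt0 //; lra.
have [L hL] := exists_nat_gt (C * (1 - ka) / (ga / 32)).
have L0 : 0 < L%:R :> R.
  by apply: le_lt_trans hL; apply: divr_ge0; [apply: mulr_ge0; rewrite ?(ltW C0) //|]; lra.
pose ep := (1 - ka) / L%:R.
have ep0 : 0 < ep by rewrite divr_gt0 // subr_gt0.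
have epC : C * ep <= ga / 32.
  have : C * (1 - ka) < L%:R * (ga / 32) by rewrite -ltr_pdivrMr //; lra.
  have epL : ep * L%:R = 1 - ka by rewrite /ep divfK // gt_eqF.
  have E : C * ep * L%:R = C * (1 - ka) by rewrite -mulrA epL.
  rewrite -(ler_pM2r L0) E; lra.
have main j : (j <= L)%N -> forall al, a < al -> al <= a + de ->
    ugood (1 - j%:R * ep) al e0.
  elim: j => [|j IH] jL al al1 al2.
    rewrite mulr0n mul0r subr0; apply: good_start => //.
    have : r%:R * a <= r%:R * al by rewrite ler_wpM2l ?ltW.
    lra.
  have jep : j.+1%:R * ep <= 1 - ka.
    have -> : 1 - ka = L%:R * ep by rewrite /ep mulrC divfK // gt_eqF.
    by rewrite ler_wpM2r ?(ltW ep0) // ler_nat.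
  have jE : j.+1%:R * ep = j%:R * ep + ep by rewrite -natr1 mulrDl mul1r.
  have jep0 : 0 <= j%:R * ep by rewrite mulr_ge0 // ltW.
  (* One third of the gap is for the earlier steps, one for the deletion, one for polishing. *)
  pose d := (al - a) / 3.
  have d0 : 0 < d by rewrite divr_gt0 // subr_gt0.
  have dE : a + d + d + d = al by rewrite /d; field.
  have dde : d <= de by rewrite /d; lra.
  clearbody d.
  have g1 : ugood (1 - j%:R * ep) (a + d) e0.
    by apply: IH; [exact: ltnW|lra|lra].
  have hal : (r%:R - 1) * (a + d) <= 1 - s / 2.
    have : (r%:R - 1) * d <= (r%:R - 1) * de by rewrite ler_wpM2l ?subr_ge0 //; lra.
    lra.
  have g2 : ugood (1 - j.+1%:R * ep) (a + d + d) (2 * r%:R * e0 +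
      C * (1 - j%:R * ep - (1 - j.+1%:R * ep))).
    by apply: (good_shrink _ _ _ _ _ _ hal (ltW e00) g1); lra.
  apply: (polish _ (a + d + d) al _ e0 _ _ _ _ _ _ _ g2); lra.
exists (a + de); first by lra.
move=> al al1 al2.
have g1 : ugood ka ((a + al) / 2) e0.
  have -> : ka = 1 - L%:R * ep by rewrite /ep mulrC divfK ?gt_eqF //; ring.
  by apply: main => //; lra.
pose y := Num.min eta (ga / 8).
apply: (@good_mono R r sgraph (komlos_degrees a s) (uvertex r) (@uedge r) (uset r ka) al al y eta) => //.
  by rewrite ge_min lexx.
apply: (polish ka ((a + al) / 2) al e0 y) => //; try lra.
- by rewrite lt_min eta0 /=; lra.
- by rewrite ge_min lexx orbT.
Qed.

(** With [ka] so small that [C * ka] is at most [eta / 2], all remaining universal vertices can be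
    deleted in a single step. *)
Lemma good_base (eta : R) : 0 < eta ->
  exists2 amax : R, a < amax & forall al, a < al -> al <= amax -> ugood 0 al eta.
Proof.
move=> eta0.
have a0 : 0 < a by apply: lt_le_trans le_s_a.
have r2 : 2 <= r%:R :> R by rewrite ler_nat.
have s0 := s_gt0; have sa := le_s_a; have asE' := asE.
have r2a : 0 <= (r%:R - 2) * a by rewrite mulr_ge0 ?subr_ge0 // ltW.
pose C := 2 * r%:R * (4 / s + r%:R).
have C0 : 0 < C.
  have : 0 < 4 / s by rewrite divr_gt0.
  by move=> h; rewrite /C !mulr_gt0 //; lra.
have CE : 2 * r%:R * (4 / s + r%:R) = C by [].
clearbody C.
pose ka := Num.min 2^-1 (eta / (2 * C)).
have eC : 0 < eta / (2 * C) by apply: divr_gt0 => //; apply: mulr_gt0.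
have ka0 : 0 < ka by rewrite lt_min eC andbT; lra.
have ka1 : ka <= 2^-1 by rewrite ge_min lexx.
have kaC : C * ka <= eta / 2.
  have : ka <= eta / (2 * C) by rewrite ge_min lexx orbT.
  by rewrite ler_pdivlMr ?mulr_gt0 //; lra.
have r0 : 0 < r%:R :> R by lra.
have e4 : 0 < eta / (4 * r%:R) by apply: divr_gt0 => //; apply: mulr_gt0.
have kl1 : ka < 1 by lra.
have [amax h1 h2] := good_all ka0 kl1 e4.
pose q := s / (2 * r%:R).
have q0 : 0 < q by rewrite divr_gt0 ?mulr_gt0.
have qr : q * r%:R = s / 2 by rewrite /q; field; rewrite gt_eqF.
clearbody q.
exists (Num.min amax (a + q)); first by rewrite lt_min h1 ltrDl.
move=> al al1; rewrite le_min => /andP[al2 al3].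
have q2 : q * 2 <= q * r%:R by rewrite ler_wpM2l // ltW.
have hal : (r%:R - 1) * ((a + al) / 2) <= 1 - s / 2.
  have : (r%:R - 1) * (al - a) <= (r%:R - 1) * q by rewrite ler_wpM2l ?subr_ge0; lra.
  have : 0 <= (r%:R - 1) * (al - a) by rewrite mulr_ge0 ?subr_ge0; lra.
  lra.
have g1 : ugood ka ((a + al) / 2) (eta / (4 * r%:R)) by apply: h2; lra.
have er : 2 * r%:R * (eta / (4 * r%:R)) = eta / 2 by field; rewrite gt_eqF.
have g2 : ugood 0 al (eta / 2 + C * (ka - 0)).
  by rewrite -er -CE; apply: (good_shrink _ _ _ _ _ _ hal (ltW e4) g1) => //; lra.
by apply: good_mono g2; lra.
Qed.
End Outer.

(** * Copies of H inside a tile *)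

Lemma bigminn_le (I : finType) (d : nat) (P : pred I) (F : I -> nat) i :
  P i -> (\big[minn/d]_(j | P j) F j <= F i)%N.
Proof.
move=> Pi; have : i \in index_enum I by rewrite mem_index_enum.
elim: (index_enum I) => // x l IH; rewrite inE big_cons => /orP[/eqP <-|il].
  by rewrite Pi geq_minl.
by case: ifP => _; rewrite ?geq_min IH ?orbT.
Qed.

Lemma sigma_colouring (H : sgraph) : (exists x y : H, edge x y) ->
  exists (p : nat) (c : H -> 'I_p.+2) (j0 : 'I_p.+2),
    [/\ chi H = p.+2, (forall x y, edge x y -> c x != c y),
        #|[set x | c x == j0]| = sigma H, (0 < sigma H)%N &
        (p.+2 * sigma H <= #|H|)%N].
Proof.
move=> [x0 [y0 exy]].
have [c0 c0P] : exists c : {ffun H -> 'I_(chi H)}, proper_colouring c.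
  by rewrite /chi; case: ex_minnP => k /existsP.
have chi_min k : colourable H k -> (chi H <= k)%N.
  by rewrite /chi; case: ex_minnP => m _ h /h.
have properP k (c : {ffun H -> 'I_k}) :
    reflect (forall x y, edge x y -> c x != c y) (proper_colouring c).
  apply: (iffP forallP) => [h x y|h x]; first by move/forallP: (h x) => /(_ y)/implyP.
  by apply/forallP => y; apply/implyP; apply: h.
have chi2 : (1 < chi H)%N.
  have := properP _ _ c0P _ _ exy; rewrite ltnNge; apply: contra => h.
  apply/eqP/val_inj => /=; have := ltn_ord (c0 x0); have := ltn_ord (c0 y0).
  by move: (nat_of_ord (c0 x0)) (nat_of_ord (c0 y0)) h => u v; lia.
have onto (c : {ffun H -> 'I_(chi H)}) j : proper_colouring c ->
    (0 < #|[set x | c x == j]|)%N.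
  move=> /properP cP; rewrite lt0n cards_eq0; apply/negP => /eqP E.
  have cj x : c x != j.
    by apply/negP => h; have := in_set0 x; rewrite -E inE h.
  (* An empty colour class could be dropped by [unlift], against the minimality of [chi H]; the
     default of [odflt] is never taken. *)
  have : colourable H (chi H).-1.
    have chiE : (chi H).-1.+1 = chi H by rewrite prednK // ltnW.
    pose u x := odflt (Ordinal (ltac:(by lia) : 0 < (chi H).-1)%N) (unlift j (c x)).
    apply/existsP; exists [ffun x => u x]; apply/properP => x y exy'; rewrite !ffunE.
    have := cP _ _ exy'; rewrite /u.
    case: unliftP (cj x) => [k ->|->]; last by rewrite eqxx.
    case: unliftP (cj y) => [k' ->|->]; last by rewrite eqxx.
    by move=> _ _ /=; apply: contra => /eqP ->.
  by move/chi_min; lia.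
have [c [j [cP cj]]] : exists (c : {ffun H -> 'I_(chi H)}) j,
    proper_colouring c /\ #|[set x | c x == j]| = sigma H.
  pose j0 : 'I_(chi H) := Ordinal (ltnW chi2).
  have : sigma H = #|H| \/ exists (c : {ffun H -> 'I_(chi H)}) j,
      proper_colouring c /\ #|[set x | c x == j]| = sigma H.
    rewrite /sigma; elim/big_rec: _ => [|c m cP IH]; first by left.
    set b := (X in minn X m).
    case: (leqP b m) => _; last exact: IH.
    rewrite /b; elim/big_rec: _ => [|j m' _ IH']; first by left.
    set b' := (X in minn X m').
    case: (leqP b' m') => _; last exact: IH'.
    by right; exists c, j.
  (* If the minimum is the default value [#|H|], any class attains it, being at least [sigma H]. *)
  case=> // sE; exists c0, j0; split=> //; rewrite sE.
  apply/eqP; rewrite eqn_leq max_card -{1}sE /sigma.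
  apply: leq_trans (bigminn_le _ _ c0P) _; exact: bigminn_le.
have ge k : (sigma H <= #|[set x | c x == k]|)%N.
  rewrite /sigma; apply: leq_trans (bigminn_le _ _ cP) _; exact: bigminn_le.
have sigma0 : (0 < sigma H)%N by rewrite -cj onto.
have sumH : (chi H * sigma H <= #|H|)%N.
  have -> : #|H| = (\sum_(k < chi H) #|[set x | c x == k]|)%N.
    rewrite -sum1_card (partition_big c predT) //=.
    by apply: eq_bigr => k _; rewrite sum1dep_card.
  by rewrite -[X in (X * _)%N]card_ord -sum_nat_const; apply: leq_sum => k _.
move: c j cP cj {c0 c0P onto ge chi_min} sumH; case: (chi H) chi2 => [|[|p]] // _ c j cP cj sumH.
by exists p, c, j; split=> //; apply/properP.
Qed.

Section Rotate.
Variables (p : nat).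
Local Open Scope nat_scope.

(* Maps colour [j0] to [j] and the other colours cyclically, shifted by [m], to
   the colours different from [j]; over all [m] this equalises the other classes. *)
Definition recolour (j0 j : 'I_p.+2) (m : 'I_p.+1) (i : 'I_p.+2) : 'I_p.+2 :=
  if unlift j0 i is Some k then lift j (k + m)%R else j.

Lemma recolour_inj j0 j m : injective (recolour j0 j m).
Proof.
move=> i i'; rewrite /recolour.
case: unliftP => [k ->|->]; case: unliftP => [k' ->|->] //.
- by move=> /lift_inj/addIr ->.
- by move=> /eqP; rewrite eq_sym (negbTE (neq_lift _ _)).
- by move=> /eqP; rewrite (negbTE (neq_lift _ _)).
Qed.

(** Class [j] receives colour [j0] every time, and any other class receives each of the other
    colours exactly once. *)
Lemma card_recolour (H : finType) (c : H -> 'I_p.+2) j0 j i :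
  \sum_(m < p.+1) #|[set x | recolour j0 j m (c x) == i]| =
  if i == j then p.+1 * #|[set x | c x == j0]|
  else #|H| - #|[set x | c x == j0]|.
Proof.
case: eqVneq => [->|nij].
  rewrite -[X in X * _]card_ord -sum_nat_const; apply: eq_bigr => m _.
  apply: eq_card => x; rewrite !inE /recolour.
  case: unliftP => [k ->|->]; last by rewrite !eqxx.
  by rewrite ![lift _ _ == _]eq_sym !(negbTE (neq_lift _ _)).
have /unlift_some[i' iE _] : j != i by rewrite eq_sym.
rewrite {}iE in nij *.
transitivity (\sum_(k < p.+1) #|[set x | c x == lift j0 k]|).
  rewrite (reindex_inj (h := fun m => (i' - m)%R)) /=; last first.
    by move=> m m' /addrI/oppr_inj.
  apply: eq_bigr => m _; apply: eq_card => x; rewrite !inE /recolour.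
  case: unliftP => [k ->|->].
    by rewrite !(inj_eq lift_inj) addrA subr_eq [(i' + m)%R]addrC (inj_eq (addIr i')).
  by rewrite (negbTE (neq_lift _ _)) (negbTE (neq_lift _ _)).
have : #|H| = \sum_(k < p.+2) #|[set x | c x == k]|.
  rewrite -sum1_card (partition_big c predT) //=.
  by apply: eq_bigr => k _; rewrite sum1dep_card.
rewrite (bigD1_ord j0) //= => ->.
by rewrite addKn.
Qed.
End Rotate.

Section Embed.
Variables (H G : sgraph) (r : nat).
Local Notation tile := {ffun 'I_r -> {set G}}.
Implicit Types (K : tile) (T : {set {ffun H -> G}}).
Local Notation class c i := [set x : H | c x == i].

Lemma embed_copy K (c : H -> 'I_r) :
  multipartite (@edge G) K -> (forall x y, edge x y -> c x != c y) ->
  (forall i, #|class c i| <= #|K i|)%N ->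
  exists f : {ffun H -> G}, is_copy f /\ forall x, f x \in K (c x).
Proof.
move=> mK cP cK.
(* A vertex of [H] is needed to obtain a default element of [G] for [nth]. *)
have [x0|H0] := pickP (@predT H); last first.
  have f : {ffun H -> G} by apply: finfun => x; have := H0 x.
  exists f; split=> [|x]; last by have := H0 x.
  apply/andP; split; first by apply/injectiveP => x; have := H0 x.
  by apply/forallP => x; have := H0 x.
have idx x : (index x (enum (class c (c x))) < #|K (c x)|)%N.
  by apply: leq_trans (cK _); rewrite cardE index_mem mem_enum inE.
have [g0 _] : exists g0, g0 \in K (c x0).
  by apply/card_gt0P; apply: leq_ltn_trans (idx x0).
pose f := [ffun x => nth g0 (enum (K (c x))) (index x (enum (class c (c x))))].
have fK x : f x \in K (c x) by rewrite ffunE -mem_enum mem_nth // -cardE.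
exists f; split=> //; apply/andP; split.
  apply/injectiveP => x y; have [cxy|ncxy] := eqVneq (c x) (c y); last first.
    move=> E; have := mK _ _ _ _ ncxy (fK x) (fK y).
    by rewrite E edge_irr.
  rewrite !ffunE cxy => /eqP; rewrite nth_uniq ?enum_uniq -?cardE //.
  - move=> /eqP/index_inj; apply; rewrite ?mem_enum ?inE ?cxy //.
  - by have := idx x; rewrite cxy.
apply/forallP => x; apply/forallP => y; apply/implyP => exy.
exact: mK (cP _ _ exy) (fK x) (fK y).
Qed.

Lemma tiling_add (f : {ffun H -> G}) T :
  is_copy f -> is_tiling T -> [disjoint copy_vertices f & covered T] ->
  is_tiling (f |: T) /\ covered (f |: T) = copy_vertices f :|: covered T.
Proof.
move=> hf /andP[/forall_inP hT /forall_inP dT] dfT; split; last first.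
  by rewrite /covered bigcup_setU big_set1.
have dg g : g \in T -> [disjoint copy_vertices f & copy_vertices g].
  by move=> gT; apply: disjointWr dfT; apply: bigcup_sup.
apply/andP; split.
  by apply/forall_inP => g /setU1P[->//|/hT].
apply/forall_inP => g hg; apply/forall_inP => g' hg'; apply/implyP.
case/setU1P: hg => [->|gT]; case/setU1P: hg' => [->|gT'].
- by rewrite eqxx.
- by move=> _; apply: dg.
- by move=> _; rewrite disjoint_sym dg.
- by move/forall_inP: (dT _ gT) => /(_ _ gT')/implyP.
Qed.

Lemma tiling0 : is_tiling (set0 : {set {ffun H -> G}}) /\
  covered (set0 : {set {ffun H -> G}}) = set0.
Proof.
split; last by rewrite /covered big_set0.
by apply/andP; split; apply/forall_inP => f; rewrite inE.
Qed.

Lemma tiling_union T T' :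
  is_tiling T -> is_tiling T' -> [disjoint covered T & covered T'] ->
  is_tiling (T :|: T') /\ covered (T :|: T') = covered T :|: covered T'.
Proof.
move=> /andP[/forall_inP hT /forall_inP dT] /andP[/forall_inP hT' /forall_inP dT'] dTT'.
split; last by rewrite /covered bigcup_setU.
have dis f g : f \in T -> g \in T' -> [disjoint copy_vertices f & copy_vertices g].
  by move=> fT gT; apply: disjointW dTT'; apply: bigcup_sup.
apply/andP; split; first by apply/forall_inP => g /setUP[/hT|/hT'].
apply/forall_inP => g /setUP hg; apply/forall_inP => g' /setUP hg'; apply/implyP.
case: hg hg' => gT [] gT'.
- by move/forall_inP: (dT _ gT) => /(_ _ gT')/implyP.
- by move=> _; apply: dis.
- by move=> _; rewrite disjoint_sym dis.
- by move/forall_inP: (dT' _ gT) => /(_ _ gT')/implyP.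
Qed.

Lemma embed_copies K (cs : seq {ffun H -> 'I_r}) :
  multipartite (@edge G) K ->
  (forall c, c \in cs -> forall x y, edge x y -> c x != c y) ->
  (forall i, \sum_(c <- cs) #|class c i| <= #|K i|)%N ->
  exists T K', [/\ is_tiling T, (forall i, K' i \subset K i),
    [disjoint covered T & supp K'], covered T :|: supp K' = supp K &
    forall i, #|K' i| = (#|K i| - \sum_(c <- cs) #|class c i|)%N].
Proof.
elim: cs K => [|c cs IH] K mK cP cK.
  have [t0 c0] := tiling0; exists set0, K; split=> //.
  - by rewrite c0 -setI_eq0 set0I.
  - by rewrite c0 set0U.
  - by move=> i; rewrite big_nil subn0.
have [||f [hf fK]] := @embed_copy K c mK.
- by apply: cP; rewrite inE eqxx.
- by move=> i; apply: leq_trans (cK i); rewrite big_cons leq_addr.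
have finj : injective f by case/andP: hf => /injectiveP.
pose K1 : tile := [ffun i => K i :\: copy_vertices f].
have K1K i : K1 i \subset K i by rewrite ffunE subsetDl.
have K1c i : #|K1 i| = (#|K i| - #|class c i|)%N.
  rewrite ffunE cardsD; congr (_ - _)%N.
  have -> : K i :&: copy_vertices f = f @: class c i.
    apply/setP => y; apply/setIP/imsetP => [[yK /imsetP[x _ yE]]|[x]].
      exists x => //; rewrite inE; apply: contraT => nc.
      by have := mK _ _ _ _ nc (fK x) yK; rewrite yE edge_irr.
    rewrite inE => /eqP <- ->; split=> //; exact: imset_f.
  by rewrite card_imset.
have mK1 := multipartite_sub K1K mK.
have [||T [K' [hT sK' dK' cT cK']]] := IH K1 mK1.
- by move=> c' hc'; apply: cP; rewrite inE hc' orbT.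
- move=> i; rewrite K1c; have := cK i; rewrite big_cons; lia.
have cf : [disjoint copy_vertices f & supp K1].
  rewrite -setI_eq0 -subset0; apply/subsetP => y /setIP[yf /bigcupP[i _]].
  by rewrite ffunE inE yf.
have [|hT1 cT1] := tiling_add hf hT.
  by apply: disjointWr cf; rewrite -cT subsetUl.
exists (f |: T), K'; split=> //.
- by move=> i; apply: subset_trans (sK' i) (K1K i).
- rewrite cT1 -setI_eq0 setIUl setU_eq0 !setI_eq0 dK' andbT.
  by apply: disjointWr cf; rewrite -cT subsetUr.
- rewrite cT1 -setUA cT; apply/setP => y; apply/setUP/idP => [[/imsetP[x _ ->]|]|/bigcupP[i _ yK]].
  + exact: mem_supp (fK x).
  + by move/subsetP: (supp_sub K1K); apply.
  + have [yf|yf] := boolP (y \in copy_vertices f); [by left|right].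
    by apply: (mem_supp (i := i)); rewrite ffunE inE yf yK.
- by move=> i; rewrite cK' K1c big_cons subnDA.
Qed.
End Embed.

Lemma tiling_bigcup (H G : sgraph) (I : finType) (P : pred I)
    (S : I -> {set {ffun H -> G}}) (F : I -> {set G}) :
  (forall i, P i -> is_tiling (S i) /\ covered (S i) \subset F i) ->
  (forall i j, P i -> P j -> i != j -> [disjoint F i & F j]) ->
  is_tiling (\bigcup_(i | P i) S i) /\
  #|covered (\bigcup_(i | P i) S i)| = (\sum_(i | P i) #|covered (S i)|)%N.
Proof.
move=> hS dF.
have dS i j : P i -> P j -> i != j -> [disjoint covered (S i) & covered (S j)].
  by move=> Pi Pj nij; apply: disjointW (dF _ _ Pi Pj nij); [case: (hS _ Pi)|case: (hS _ Pj)].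
split.
  apply/andP; split.
    apply/forall_inP => f /bigcupP[i Pi fi].
    by have [/andP[/forall_inP h _] _] := hS _ Pi; apply: h.
  apply/forall_inP => f /bigcupP[i Pi fi]; apply/forall_inP => g /bigcupP[j Pj gj].
  have [Eij|nij] := eqVneq i j.
    have [/andP[_ /forall_inP h] _] := hS _ Pi.
    by move/forall_inP: (h _ fi); apply; rewrite Eij.
  by apply/implyP => _; apply: disjointW (dS _ _ Pi Pj nij); apply: bigcup_sup.
have -> : covered (\bigcup_(i | P i) S i) = \bigcup_(i | P i) covered (S i).
  apply/setP => x; apply/bigcupP/bigcupP => [[f /bigcupP[i Pi fi] xf]|[i Pi /bigcupP[f fi xf]]].
    by exists i => //; apply/bigcupP; exists f.
  by exists f => //; apply/bigcupP; exists i.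
rewrite -[\bigcup_(i | P i) _]setTI card_setI_bigcup //.
by apply: eq_bigr => i _; rewrite setTI.
Qed.

Section Greedy.
Variables (R : realType) (H G : sgraph) (p : nat) (c : H -> 'I_p.+2) (j0 : 'I_p.+2) (a s : R).
Let r := p.+2.
Let sg := #|[set x | c x == j0]|.
Hypotheses (cP : forall x y, edge x y -> c x != c y) (sg_le : (r * sg <= #|H|)%N)
  (H_gt0 : (0 < #|H|)%N).
Hypotheses (s_gt0 : 0 < s) (le_s_a : s <= a) (asE : (r%:R - 1) * a + s = 1)
  (aE : a * (p.+1 * #|H|)%:R = (#|H| - sg)%:R).
Local Notation tile := {ffun 'I_r -> {set G}}.

(** In each round embed the [p + 1] copies given by all rotations, with the colour [j0] in a class
    [j] of proportion at most [a]. Every other class loses exactly [a] times the number of vertices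
    removed, so its excess over [a] stays below [E]. This continues until [s * #|supp K|] is at most
    [#|H| + (r - 1) * E]. *)
Lemma greedy_tile (E : R) : #|H|%:R <= E -> forall n (K : tile), (#|supp K| <= n)%N ->
  multipartite (@edge G) K -> (forall i, #|K i|%:R <= a * #|supp K|%:R + E) ->
  exists T : {set {ffun H -> G}}, [/\ is_tiling T, covered T \subset supp K &
    s * #|supp K|%:R <= s * #|covered T|%:R + (#|H|%:R + (r%:R - 1) * E)].
Proof.
move=> hE; elim=> [|n IH] K hn mK vK.
  have [t0 c0] := tiling0 H G; exists set0; rewrite c0 sub0set; split=> //.
  move: hn; rewrite leqn0 => /eqP ->; rewrite cards0 !mulr0 add0r.
  have : 0 <= (r%:R - 1) * E by rewrite mulr_ge0 ?subr_ge0 ?ler1n // (le_trans _ hE).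
  by have : 0 <= #|H|%:R :> R by []; lra.
have [small|big] := leP (s * #|supp K|%:R) (#|H|%:R + (r%:R - 1) * E).
  have [t0 c0] := tiling0 H G; exists set0; rewrite c0 sub0set cards0 mulr0 add0r; split=> //.
have szE : #|supp K|%:R = \sum_i #|K i|%:R :> R by rewrite (card_supp (@edge_irr G) mK) natr_sum.
have r2 : 2 <= r%:R :> R by rewrite ler_nat.
have asE' := asE; have s0 := s_gt0; have sa := le_s_a.
(* The upper bounds on the other classes leave at least [s * #|supp K| - (r - 1) * E] vertices for
   this one, enough for a round. *)
have K_big i : #|H|%:R < #|K i|%:R :> R.
  have h1 : \sum_(k | k != i) #|K k|%:R <= \sum_(k < r | k != i) (a * #|supp K|%:R + E).
    by apply: ler_sum.
  have h2 : \sum_(k < r) (a * #|supp K|%:R + E) = r%:R * (a * #|supp K|%:R + E).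
    by rewrite sumr_const card_ord mulr_natl.
  rewrite (bigD1 i) //= in h2; rewrite (bigD1 i) //= in szE.
  have h3 : (r%:R - 1) * a * #|supp K|%:R = (1 - s) * #|supp K|%:R by congr (_ * _); lra.
  lra.
have [j hj] : exists j, #|K j|%:R <= a * #|supp K|%:R.
  apply/existsP; apply: contraT => /existsPn hn'.
  have : \sum_(k < r) a * #|supp K|%:R < \sum_k #|K k|%:R.
    apply: ltr_sum => [|k _]; first by apply/hasP; exists ord0; rewrite ?mem_index_enum.
    by rewrite ltNge.
  rewrite -szE sumr_const card_ord -mulr_natl.
  have : (r%:R * a - 1) * #|supp K|%:R >= 0 by rewrite mulr_ge0 //; lra.
  lra.
pose cs := [seq [ffun x => recolour j0 j m (c x)] | m <- enum 'I_p.+1].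
have sumcs i : (\sum_(d <- cs) #|[set x | (d : {ffun H -> 'I_r}) x == i]| =
    if i == j then p.+1 * sg else #|H| - sg)%N.
  rewrite /cs big_map big_enum /= -card_recolour; apply: eq_bigr => m _.
  by apply: eq_card => x; rewrite !inE ffunE.
have sgA : (p.+1 * sg <= #|H| - sg)%N.
  by move: sg_le; rewrite /r mulSn => h; rewrite leq_subRL //; apply: leq_trans h; apply: leq_addr.
have csK i : (\sum_(d <- cs) #|[set x | (d : {ffun H -> 'I_r}) x == i]| <= #|K i|)%N.
  rewrite sumcs; apply: leq_trans (_ : #|H| <= _)%N; last by rewrite -(ler_nat R) ltW.
  by case: ifP => _; rewrite ?leq_subr // (leq_trans sgA) ?leq_subr.
have [|T1 [K' [hT1 sK' dK' cK' cardK']]] := embed_copies mK _ csK.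
  move=> d /mapP[m _ ->] x y exy; rewrite !ffunE.
  by rewrite (inj_eq (@recolour_inj _ _ _ _)) cP.
have mK' := multipartite_sub sK' mK.
have suppE : #|supp K| = (#|covered T1| + #|supp K'|)%N.
  rewrite -cK' cardsU (_ : _ :&: _ = set0) ?cards0 ?subn0 //.
  by apply/eqP; rewrite setI_eq0.
have csz : #|supp K|%:R = #|supp K'|%:R + (p.+1 * #|H|)%:R :> R.
  have -> : (p.+1 * #|H| = \sum_(i < r) \sum_(d <- cs) #|[set x | (d : {ffun H -> 'I_r}) x == i]|)%N.
    rewrite (bigD1 j) //= sumcs eqxx (eq_bigr (fun=> #|H| - sg)%N) => [|i nij].
      by rewrite sum_nat_const cardC1 card_ord /= -mulnDr subnKC // max_card.
    by rewrite sumcs (negbTE nij).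
  rewrite szE (card_supp (@edge_irr G) mK') !natr_sum -big_split /=.
  by apply: eq_bigr => i _; rewrite cardK' natrB // subrK.
have p1H : (0 < p.+1 * #|H|)%N by rewrite muln_gt0.
have [||T2 [hT2 sT2 cT2]] := IH K' _ mK'.
- by rewrite -ltnS -(ltr_nat R) (lt_le_trans _ (_ : #|supp K|%:R <= _)) ?ler_nat // csz ltrDl ltr0n.
- move=> i; rewrite cardK' natrB // sumcs.
  have := vK i; rewrite csz mulrDr aE.
  (* Class [j] had no excess before and loses too little by at most [#|H|], which is at most [E]. *)
  case: eqP => [->|_]; last lra.
  rewrite csz mulrDr aE in hj.
  have : 0 <= (p.+1 * sg)%:R :> R by [].
  have : (#|H| - sg)%:R <= #|H|%:R :> R by rewrite ler_nat leq_subr.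
  lra.
have dT : [disjoint covered T1 & covered T2] by apply: disjointWr dK'.
have [hT cT] := tiling_union hT1 hT2 dT.
exists (T1 :|: T2); split=> //.
  by rewrite cT subUset -cK' subsetUl /= (subset_trans sT2) ?subsetUr.
rewrite suppE cT cardsU (_ : _ :&: _ = set0) ?cards0 ?subn0; last first.
  by apply/eqP; rewrite setI_eq0.
rewrite !natrD; lra.
Qed.
End Greedy.

(** * From tiles to copies of [H], and the theorem *)

Lemma komlos_tiling (R : realType) (eta : R) (H : sgraph) (p : nat) (c : H -> 'I_p.+2)
    (j0 : 'I_p.+2) (a s : R) :
  let sg := #|[set x | c x == j0]| in
  0 < eta -> (forall x y, edge x y -> c x != c y) -> (p.+2 * sg <= #|H|)%N ->
  (0 < #|H|)%N -> 0 < s -> s <= a -> (p.+2%:R - 1) * a + s = 1 ->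
  a * (p.+1 * #|H|)%:R = (#|H| - sg)%:R ->
  exists n0 : nat, forall G : sgraph, (n0 <= #|G|)%N -> komlos_degrees a s G ->
    exists T : {set {ffun H -> G}},
      is_tiling T /\ #|~: covered T|%:R <= eta * #|G|%:R.
Proof.
move=> sg eta0 cP sg_le H0 s0 sa asE aE.
have r2 : 2 <= p.+2%:R :> R by rewrite ler_nat.
have r0 : 0 < p.+2%:R :> R by lra.
have eta4 : 0 < eta / 4 by rewrite divr_gt0.
have [amax amax_gt hgood] := good_base (isT : (1 < p.+2)%N) s0 sa asE eta4.
(* The excess [d] and the tile size [t] are chosen such that the loss [M] in a tile, with
   [E = d * sz + #|H|], is at most [s * (eta / 2) * sz]: one half for the terms in [d], one for
   those in [#|H|]. *)
pose d := Num.min (amax - a) (eta / 4 * s / p.+2%:R).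
have d0 : 0 < d by rewrite lt_min subr_gt0 amax_gt /= divr_gt0 // mulr_gt0.
have dr : d * p.+2%:R <= eta / 4 * s by rewrite -ler_pdivlMr // ge_min lexx orbT.
have d1 : d <= amax - a by rewrite ge_min lexx.
clearbody d.
have [t ht] := exists_nat_gt (p.+2%:R * #|H|%:R / (eta / 4 * s)).
have es : 0 < eta / 4 * s by apply: mulr_gt0.
rewrite ltr_pdivrMr // in ht.
have al1 : a < a + d by lra.
have al2 : a + d <= amax by lra.
have [t0 [n0 hn0]] := hgood _ al1 al2 t.
exists n0 => G nG hG.
pose i0 : 'I_p.+2 := ord0.
(* For parameter 0 only layer 0 remains, and [phi] identifies it with [G]. *)
have W0 : uset p.+2 (0 : R) G = [set v : uvertex p.+2 G | v.2 == i0].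
  by apply/setP => v; rewrite !inE /ucut mul0r truncn0 ltn0 orbF.
pose phi (A : {set uvertex p.+2 G}) := [set x : G | (x, i0) \in A].
have cphi (A : {set uvertex p.+2 G}) : A \subset uset p.+2 (0 : R) G -> #|phi A| = #|A|.
  move=> /subsetP sA; rewrite -(card_imset _ (_ : injective (fun x : G => (x, i0))));
    last by move=> x y [].
  apply: eq_card => v; apply/imsetP/idP => [[x]|vA]; first by rewrite inE => xA ->.
  by exists v.1; have := sA _ vA; rewrite W0 !inE => /eqP <-; rewrite -surjective_pairing.
have cW0 : #|uset p.+2 (0 : R) G| = #|G|.
  rewrite -cphi // -[RHS]cardsT; congr #|pred_of_set _|.
  by apply/setP => x; rewrite in_setT inE W0 inE eqxx.
have [||T [hT hPsi]] := hn0 G; rewrite ?cW0 //.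
have [hT1 dT] := hT.
have sW K : K \in T -> supp K \subset uset p.+2 (0 : R) G by case/hT1.
have mem_phi (K : {ffun 'I_p.+2 -> {set uvertex p.+2 G}}) i : K \in T ->
    K i \subset uset p.+2 (0 : R) G.
  by move=> KT; apply: subset_trans (sub_supp _ _) (sW _ KT).
pose M (K : {ffun 'I_p.+2 -> {set uvertex p.+2 G}}) : R :=
  #|H|%:R + (p.+2%:R - 1) * (d * #|supp K|%:R + #|H|%:R).
have : forall K : {ffun 'I_p.+2 -> {set uvertex p.+2 G}}, exists S : {set {ffun H -> G}},
    K \in T -> [/\ is_tiling S, covered S \subset phi (supp K) &
      s * #|supp K|%:R <= s * #|covered S|%:R + M K].
  move=> K; have [KT|KT] := boolP (K \in T); last by exists set0.
  pose K' : {ffun 'I_p.+2 -> {set G}} := [ffun i => phi (K i)].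
  have sK' : supp K' = phi (supp K).
    apply/setP => x; rewrite inE; apply/bigcupP/bigcupP => [[i _]|[i _ xK]].
      by rewrite ffunE inE => xK; exists i.
    by exists i => //; rewrite ffunE inE.
  have cK' i : #|K' i| = #|K i| by rewrite ffunE cphi // mem_phi.
  have cK : #|supp K'| = #|supp K| by rewrite sK' cphi // sW.
  have [_ mK vK _] := hT1 _ KT.
  have mK' : multipartite (@edge G) K'.
    move=> i j x y nij; rewrite !ffunE !inE => xK yK.
    by have := mK _ _ _ _ nij xK yK; rewrite /uedge /=.
  have dK : 0 <= d * #|supp K|%:R by rewrite mulr_ge0 // ltW.
  have hE : #|H|%:R <= d * #|supp K|%:R + #|H|%:R by rewrite lerDr.
  have [|S [hS cS lS]] := greedy_tile cP sg_le H0 s0 sa asE aE hE (leqnn _) mK'.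
    move=> i; rewrite cK' cK; have := vK i.
    by have : 0 <= #|H|%:R :> R by []; lra.
  by exists S => _; rewrite -sK' -cK.
move/(@fin_all_exists _ _) => [S hS].
have [||hU cU] := @tiling_bigcup H G _ (mem T) S (fun K => phi (supp K)).
- by move=> K /hS[].
- move=> K K' KT K'T nKK'; rewrite -setI_eq0 -subset0; apply/subsetP => x.
  rewrite !inE => /andP[xK xK']; have := dT _ _ KT K'T nKK'.
  by rewrite -setI_eq0 => /eqP/setP/(_ (x, i0)); rewrite !inE xK xK'.
exists (\bigcup_(K in T) S K); split=> //.
set U := covered _ in cU *.
have E1 : #|G|%:R = #|U|%:R + #|~: U|%:R :> R by rewrite -natrD cardsC.
have E2 : #|uset p.+2 (0 : R) G|%:R = #|cov T|%:R + #|uset p.+2 (0 : R) G :\: cov T|%:R :> R.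
  by rewrite -natrD -[in LHS](cardsID (cov T)) (setIidPr (cov_sub hT)).
rewrite cW0 in E2 hPsi.
have E3 := Psi_ge R (@uedge p.+2 G) (uset p.+2 (0 : R) G) T.
have E4 : s * #|cov T|%:R <= s * #|U|%:R + s * (eta / 2 * #|cov T|%:R).
  rewrite cU (card_cov hT) !natr_sum !mulr_sumr -big_split /=.
  apply: ler_sum => K KT; have [_ _ h] := hS K KT; apply: le_trans h _.
  rewrite lerD2l /M; have [_ _ _ /andP[tK _]] := hT1 _ KT.
  have tK' : eta / 4 * s * t%:R <= eta / 4 * s * #|supp K|%:R.
    by rewrite ler_wpM2l ?ler_nat // ltW // mulr_gt0.
  have dK : d * p.+2%:R * #|supp K|%:R <= eta / 4 * s * #|supp K|%:R by rewrite ler_wpM2r.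
  have dK0 : 0 <= d * #|supp K|%:R by rewrite mulr_ge0 // ltW.
  lra.
have E5 : #|cov T|%:R <= #|U|%:R + eta / 2 * #|cov T|%:R.
  by rewrite -(ler_pM2l s0) mulrDr.
(* The tiles miss at most [eta / 2 * #|G|] vertices because [Psi] is at most [eta / 4 * #|G|]; at
   most as many are lost inside the tiles. *)
have E6 : eta / 2 * #|cov T|%:R <= eta / 2 * #|G|%:R.
  rewrite ler_wpM2l ?divr_ge0 ?(ltW eta0) // E2 lerDl //.
lra.
Qed.

Theorem theorem1p4 (R : realType) (eta : R) (eta_gt0 : 0 < eta)
    (H : sgraph) (H_edge : exists x y : H, edge x y) :
  exists n0 : nat, forall (G : sgraph) (n : nat),
    #|G| = n -> (n0 <= n)%N ->
    (forall i : nat, (1 <= i)%N -> i%:R <= omega R H * n%:R / #|H|%:R ->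
       (1 - (omega R H + (sigma H)%:R) / #|H|%:R) * n%:R
         + (sigma H)%:R / omega R H * i%:R <= (dseq G i)%:R) ->
    exists T : {set {ffun H -> G}},
      is_tiling T /\ #|~: covered T|%:R <= eta * n%:R.
Proof.
have [p [c [j0 [chiE cP cj sg0 sgH]]]] := sigma_colouring H_edge.
have H0 : (0 < #|H|)%N by apply: leq_trans sgH; rewrite muln_gt0.
have hR : 0 < #|H|%:R :> R by rewrite ltr0n.
have sR : 0 < (sigma H)%:R :> R by rewrite ltr0n.
have omE : omega R H = (#|H|%:R - (sigma H)%:R) / p.+1%:R.
  by rewrite /omega chiE -[p.+2%:R]natr1 addrK.
have pR : 0 < p.+1%:R :> R by rewrite ltr0n.
have sgHR : p.+2%:R * (sigma H)%:R <= #|H|%:R :> R by rewrite -natrM ler_nat.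
rewrite -natr1 mulrDl mul1r in sgHR.
(* The smallest class is at most the average [omega] of the other ones. *)
have om_ge : (sigma H)%:R <= omega R H.
  by rewrite omE ler_pdivlMr // mulrC; lra.
have om0 : 0 < omega R H by apply: lt_le_trans om_ge.
have omp : omega R H * p.+1%:R = #|H|%:R - (sigma H)%:R.
  by rewrite omE divfK // gt_eqF.
(* Normalising by [#|H|] turns [omega] and [sigma] into [a] and [s]. *)
have [|||||n0 hn0] := @komlos_tiling R eta H p c j0 (omega R H / #|H|%:R)
    ((sigma H)%:R / #|H|%:R) eta_gt0 cP _ H0.
- by rewrite cj.
- by rewrite divr_gt0.
- by rewrite ler_pM2r ?invr_gt0.
- rewrite -[p.+2%:R]natr1 addrK mulrA -mulrDl mulrC.
  by rewrite mulrC [p.+1%:R * _]mulrC omp subrK divff // gt_eqF.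
- rewrite cj natrM natrB; last by rewrite (leq_trans _ sgH) // leq_pmull.
  by rewrite -omp; field; rewrite gt_eqF.
exists n0 => G n <- nG hG; apply: hn0 => // i i1 ia.
have := hG i i1; rewrite mulrAC ia => /(_ isT); apply: le_trans.
rewrite -addrA -opprD -mulrDl lerD2l ler_wpM2r //.
by rewrite invfM invrK mulrACA mulVf ?mulr1 ?gt_eqF.
Qed.
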